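(* Let $N$ be a feed-forward network, $f\in\mathcal{V}_k(N)$ generic and $L$ a feed-forward lift of $N$ such that $L$ is backward connected. (i) If $L$ is a lift that creates new layers, or a lift inside a layer other than the first layer, then every bifurcation branch of $f$ on $L$ is lifted from $N$. (ii) If $L$ is a lift inside the first layer, then there is at least one bifurcation branch of $f$ on $L$ which is not lifted from $N$.
   Context: A network $N$ with $k$ edge types is a finite set of cells $C$ together with functions $\sigma_1,\dots,\sigma_k:C\to C$ ($\sigma_i(c)$ is the source of the unique edge of type $i$ targeting $c$); $|N|=|C|$. Networks represented by $(\sigma_i:C\to C)$ and $(\sigma_i':C'\to C')$ are equal if there is a bijection $\varphi:C\to C'$ with $\varphi\circ\sigma_i=\sigma_i'\circ\varphi$ for all $i$. A feed-forward network is a network whose cells can be partitioned into nonempty layers $C_0,\dots,C_m$ ($C_0$ is the first layer) such that $\sigma_i(c)=c$ for $c\in C_0$ and all $i$; $\sigma_i(C_j)\subseteq C_{j-1}$ for $1\le j\le m$ and all $i$; and for $0\le j\le m-1$ every $c\in C_j$ equals $\sigma_i(c')$ for some $c'\in C_{j+1}$ and some $i$. Feed-forward networks are assumed connected (as undirected graphs). A network is backward connected if there is a cell $c$ such that every other cell $c'$ can be joined to $c$ by a directed path from $c'$ to $c$. A coloring is an equivalence relation $\bowtie$ on the cells; it is balanced if $c\bowtie c'$ implies $\sigma_i(c)\bowtie\sigma_i(c')$ for all $i$. The quotient network $N/\bowtie$ has the $\bowtie$-classes as cells and is represented by $\sigma_i^{\bowtie}([c]_{\bowtie})=[\sigma_i(c)]_{\bowtie}$.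 $L$ is a lift of $N$ if $N=L/\bowtie$ for some balanced coloring $\bowtie$ in $L$. For a feed-forward lift $L$ (layers $C'_0,\dots,C'_n$) of a feed-forward network $N$ (layers $C_0,\dots,C_m$): $L$ is a lift inside the layer $C_j$ if $m=n$, $|C'_j|\ne|C_j|$ and $|C'_i|=|C_i|$ for $i\ne j$; $L$ is a lift that creates $n-m$ new layers if $m<n$, $|C'_0|=\dots=|C'_{n-m}|=|C_0|$ and $|C'_{n-m+j}|=|C_j|$ for $1\le j\le m$. $\mathcal{V}(N)$ is the set of smooth $f:\mathbb{R}\times\mathbb{R}^k\times\mathbb{R}\to\mathbb{R}$, $(x_0,x_1,\dots,x_k,\lambda)\mapsto f$, with $f(0,\dots,0,\lambda)=0$ for all $\lambda$; $f_i=\partial f/\partial x_i$ at the origin. $\mathcal{V}_k(N)=\{f\in\mathcal{V}(N):\sum_{i=0}^k f_i=0\}$. It depends only on $k$, so $\mathcal{V}_k(N)=\mathcal{V}_k(L)$. The vector field is $(f^N(x,\lambda))_c=f(x_c,x_{\sigma_1(c)},\dots,x_{\sigma_k(c)},\lambda)$ on $\mathbb{R}^{|N|}$. ''Generic'' means: there is an open dense subset $O$ of the space of possible values of the first and second order partial derivatives at the origin of elements of the class, such that the statement holds for every $f$ in the class whose derivatives lie in $O$. A domain is an interval $]-\lambda_0,0]$, $]-\lambda_0,\lambda_0[$ or $[0,\lambda_0[$ with $\lambda_0>0$. An equilibrium branch of $f$ on $N$ is a function $b:D\to\mathbb{R}^{|N|}$ on a domain $D$ with $b(0)=0$ and $f^N(b(\lambda),\lambda)=0$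 for all $\lambda\in D$, which is smooth if $D=]-\lambda_0,\lambda_0[$, and continuous on $D$ and smooth on $D\setminus\{0\}$ if $D$ is one-sided. Branches are taken as germs: $b_1:D_1\to\mathbb{R}^{|N|}$ and $b_2:D_2\to\mathbb{R}^{|N|}$ are related if there is an open neighborhood $U$ of $0$ with $U\cap D_1\cap D_2\ne\{0\}$ and $b_1=b_2$ on $U\cap D_1\cap D_2$; germ equivalence is the transitive closure, and equivalent branches are identified. The bifurcation branches are the equilibrium branches different from the trivial branch $0$. A bifurcation branch $b$ of $f$ on $L$ is lifted from $N$ if there is a balanced coloring $\bowtie$ in $L$ with $N=L/\bowtie$ and $b\in\Delta_{\bowtie}$, i.e. $b(\lambda)\in\Delta_{\bowtie}=\{x: c\bowtie d\Rightarrow x_c=x_d\}$ for all $\lambda$ in the domain near $0$. *)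

(* Defs.v *)
From mathcomp Require Import all_boot all_order all_algebra generic_quotient.
From mathcomp Require Import all_classical all_reals all_analysis.
From Stdlib Require Import Relation_Operators.

Set Implicit Arguments.
Unset Strict Implicit.
Unset Printing Implicit Defensive.

Import Order.TTheory GRing.Theory Num.Theory.
Import numFieldNormedType.Exports.

Local Open Scope ring_scope.
Local Open Scope classical_set_scope.
Local Open Scope quotient_scope.

(** * Networks *)

(* [src i c] is the source of the unique edge of type [i] that targets [c]. *)
Record network (k : nat) := Network {
  cell :> finType;
  src : 'I_k -> cell -> cell
}.

Definition network_eq k (N N' : network k) : Prop :=
  exists phi : N -> N',
    bijective phi /\ forall i c, phi (src i c) = src i (phi c).

(* [edge c d]: there is an edge from [c] to [d]. *)
Definition edge k (N : network k) : rel N :=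
  fun c d => [exists i, src i d == c].

Definition connected_network k (N : network k) : Prop :=
  forall c d : N, connect (fun a b => edge a b || edge b a) c d.

Definition backward_connected k (N : network k) : Prop :=
  exists c : N, forall c' : N, c' != c -> connect (@edge k N) c' c.

(* The partition into the layers C_0, ..., C_m is encoded by the function [lay]
   giving the index of the layer of each cell: C_j is [layer lay j]. *)
Definition layer (T : finType) (lay : T -> nat) (j : nat) : {set T} :=
  [set c | lay c == j]%SET.

Record feed_forward k (N : network k) (m : nat) (lay : N -> nat) : Prop :=
  FeedForward {
    ff_bound : forall c, (lay c <= m)%N;
    ff_nonempty : forall j, (j <= m)%N -> exists c, lay c = j;
    ff_first : forall i c, lay c = 0%N -> src i c = c;
    ff_next : forall i c j, lay c = j.+1 -> lay (src i c) = j;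
    ff_onto : forall j c, (j < m)%N -> lay c = j ->
      exists i c', lay c' = j.+1 /\ c = src i c';
    ff_connected : connected_network N
  }.

(** * Balanced colorings, quotients and lifts *)

Definition balanced k (N : network k) (r : equiv_rel N) : Prop :=
  forall i (c d : N), r c d -> r (src i c) (src i d).

Section Quotient.
Variables (k : nat) (N : network k) (r : equiv_rel N).

Definition quotient_cell : finType := quot_type {eq_quot r}.

Definition class_of (c : N) : quotient_cell := \pi_{eq_quot r} c.

Definition quotient_src (i : 'I_k) (q : quotient_cell) : quotient_cell :=
  class_of (src i (repr (q : {eq_quot r}))).

Definition quotient_network : network k :=
  Network quotient_src.

Lemma class_ofP c d : class_of c = class_of d <-> r c d.
Proof. by split=> [|h]; [move/eqmodP | apply/eqmodP]. Qed.

(* The choice of representatives is irrelevant for a balanced coloring. *)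
Lemma quotient_srcE : balanced r -> forall i (c : N),
  quotient_src i (class_of c) = class_of (src i c).
Proof. by move=> hr i c; apply/class_ofP/hr/class_ofP/reprK. Qed.

End Quotient.

Definition is_lift k (N L : network k) : Prop :=
  exists r : equiv_rel L, balanced r /\ network_eq N (quotient_network r).

(* The next two predicates only compare the sizes of the layers; they are meant
   for feed-forward networks [N] and [L] such that [L] is a lift of [N]. *)
Definition lift_inside_layer k (N : network k) m (layN : N -> nat)
    (L : network k) n (layL : L -> nat) (j : nat) : Prop :=
  [/\ m = n, (j <= m)%N, #|layer layL j| <> #|layer layN j| &
      forall i, (i <= m)%N -> i <> j -> #|layer layL i| = #|layer layN i|].

Definition lift_creates_layers k (N : network k) m (layN : N -> nat)
    (L : network k) n (layL : L -> nat) : Prop :=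
  [/\ (m < n)%N,
      forall i, (i <= n - m)%N -> #|layer layL i| = #|layer layN 0%N| &
      forall j, (1 <= j <= m)%N ->
        #|layer layL (n - m + j)| = #|layer layN j| ].

(** * Coupled vector fields *)

(* R x R^k x R is identified with R^(k+2): coordinate 0 is x_0, coordinates
   1, ..., k are x_1, ..., x_k and the last coordinate is the parameter. *)
Definition point (R : realType) (k : nat) (x0 : R) (x : 'I_k -> R) (lam : R) :
    'rV[R]_k.+2 :=
  \row_j if unlift ord0 j is Some j' then
           if unlift ord_max j' is Some i then x i else lam
         else x0.

Definition partial (R : realType) n (i : 'I_n) (f : 'rV[R]_n -> R) :
    'rV[R]_n -> R :=
  fun x => 'D_(delta_mx 0 i) f x.

(* C^oo: every iterated partial derivative is differentiable everywhere. *)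
Definition smooth (R : realType) n (f : 'rV[R]_n -> R) : Prop :=
  forall (s : seq 'I_n) (x : 'rV[R]_n),
    differentiable (foldr (@partial R n) f s) x.

Definition admissible (R : realType) k (f : 'rV[R]_k.+2 -> R) : Prop :=
  smooth f /\ forall lam, f (point 0 (fun=> 0) lam) = 0.

(* The set V_k: the derivative with respect to the parameter does not enter the
   sum. *)
Definition Vk (R : realType) k : set ('rV[R]_k.+2 -> R) :=
  [set f | admissible f /\ \sum_(j < k.+2 | j != ord_max) partial j f 0 = 0].

Definition vector_field (R : realType) k (f : 'rV[R]_k.+2 -> R)
    (N : network k) (x : N -> R) (lam : R) : N -> R :=
  fun c => f (point (x c) (fun i => x (src i c)) lam).

(** * Genericity *)

Definition jet2 (R : realType) n (f : 'rV[R]_n -> R) : 'rV[R]_n * 'M[R]_n :=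
  (\row_i partial i f 0, \matrix_(i, j) partial i (partial j f) 0).

(* [O] is open and dense in the set [jet2 @` A] of possible values, for the
   subspace topology. *)
Definition generic (R : realType) n (A : set ('rV[R]_n -> R))
    (P : ('rV[R]_n -> R) -> Prop) : Prop :=
  exists O : set ('rV[R]_n * 'M[R]_n),
    [/\ exists2 U, open U & O = U `&` (@jet2 R n @` A),
        @jet2 R n @` A `<=` closure O &
        forall f, A f -> O (jet2 f) -> P f].

(** * Bifurcation branches *)

(* A function from [dom] to R^|N|; the values of [val] outside [dom] are
   irrelevant. *)
Record branch (R : realType) k (N : network k) := Branch {
  dom : set R;
  bval :> R -> N -> R
}.

Definition smooth_on (R : realType) (D : set R) (g : R -> R) : Prop :=
  forall n t, D t -> derivable (g^`(n)) t 1.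

Definition branch_regular (R : realType) k (N : network k) (b : branch R N) :
    Prop :=
  exists2 l0 : R, 0 < l0 &
    (dom b = `]- l0, l0[%classic /\
       forall c, smooth_on (dom b) (b ^~ c)) \/
    ((dom b = `]- l0, 0]%classic \/ dom b = `[0, l0[%classic) /\
       forall c, {within dom b, continuous (b ^~ c)} /\
                 smooth_on (dom b `\ 0) (b ^~ c)).

Definition equilibrium_branch (R : realType) k (f : 'rV[R]_k.+2 -> R)
    (N : network k) (b : branch R N) : Prop :=
  [/\ branch_regular b, forall c, b 0 c = 0 &
      forall lam, dom b lam -> forall c, vector_field f (b lam) lam c = 0].

Definition related (R : realType) k (N : network k) (b1 b2 : branch R N) :
    Prop :=
  exists U : set R,
    [/\ open U, U 0, U `&` dom b1 `&` dom b2 <> [set 0] &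
        forall t, (U `&` dom b1 `&` dom b2) t -> forall c, b1 t c = b2 t c].

(* The relation is closed transitively inside the set of the equilibrium
   branches of [f] on [N]. *)
Definition germ_eq (R : realType) k (f : 'rV[R]_k.+2 -> R) (N : network k) :
    branch R N -> branch R N -> Prop :=
  clos_trans (branch R N) (fun b1 b2 =>
    [/\ equilibrium_branch f b1, equilibrium_branch f b2 & related b1 b2]).

Definition trivial_branch (R : realType) k (N : network k) : branch R N :=
  Branch `]- 1, 1[%classic (fun _ _ => 0).

Definition bifurcation_branch (R : realType) k (f : 'rV[R]_k.+2 -> R)
    (N : network k) (b : branch R N) : Prop :=
  equilibrium_branch f b /\ ~ germ_eq f b (trivial_branch R N).

(* The synchrony space Delta of a coloring. *)
Definition synchrony (R : realType) k (N : network k) (r : equiv_rel N) :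
    set (N -> R) :=
  [set x | forall c d : N, r c d -> x c = x d].

Definition lifted_from (R : realType) k (N L : network k) (b : branch R L) :
    Prop :=
  exists r : equiv_rel L,
    [/\ balanced r, network_eq N (quotient_network r) &
        \forall t \near (0 : R), dom b t -> synchrony r (b t)].

(* Main.v *)
Require Import Defs.
From mathcomp Require Import all_boot all_order all_algebra.
From mathcomp Require Import all_classical all_reals all_analysis.
From mathcomp Require Import ring lra.

(** A lift is a surjective homomorphism [p : L -> N]. As [L] is backward
connected, [p] is determined by the image of the top cell, which can only be the
top cell of [N]; so the coloring exhibiting [L] as a lift is unique, and [p]
shifts layers by [n - m], truncated at the first layer of [N].

Generically [f_0 <> 0], so the state of a cell is locally a function of the
states of its sources and of the parameter. Hence two cells with the same image
under [p] have the same state as soon as this is so in the first layer, which is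
automatic if [p] is injective there: this is (i).

If two first-layer cells [c <> d] have the same image, put [c] on the
transcritical branch [beta] of [f(x, ..., x, l) = 0], put the other first-layer
cells at [0], and solve for the other layers by the implicit function theorem.
It is enough to do so on [[0, l0[], where [beta] is found by the intermediate
value theorem in a sector around the line [x = y0 * l], and is smooth away from
the origin because its defining equation is nondegenerate there. The inequality
[e * |t| <= |b_c(t) - b_d(t)|] near [0] survives germ equivalence, as a two-sided
branch has a derivative at [0]; so no branch equivalent to [b] identifies the
states of [c] and [d], which gives (ii). *)

Set Implicit Arguments.
Unset Strict Implicit.
Unset Printing Implicit Defensive.

Import Order.TTheory GRing.Theory Num.Theory.
Import numFieldNormedType.Exports.

Local Open Scope ring_scope.
Local Open Scope classical_set_scope.

(* MathComp-Analysis already uses the name [point]. *)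
Local Notation input := Defs.point.

(** * Homomorphisms of layered networks *)

Definition network_hom k (L N : network k) (p : L -> N) : Prop :=
  forall i c, p (src i c) = src i (p c).

Definition surj_hom k (L N : network k) (p : L -> N) : Prop :=
  network_hom p /\ forall y, exists c, p c = y.

Lemma quotient_hom k (N L : network k) (r : equiv_rel L) :
  balanced r -> network_eq N (quotient_network r) ->
  exists p : L -> N, surj_hom p /\ forall c d, r c d <-> p c = p d.
Proof.
move=> rbal [phi [[psi phiK psiK] phi_src]].
exists (fun c => psi (class_of r c)); split; first split.
- move=> i c; apply: (can_inj phiK).
  by rewrite phi_src !psiK -(quotient_srcE rbal).
- move=> y; have [c yE] : exists c, class_of r c = phi y.
    by exists (repr (phi y)); exact: reprK.
  by exists c; rewrite yE phiK.
- move=> c d; split=> [/class_ofP -> //|/(can_inj psiK) ?]; exact/class_ofP.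
Qed.

(** Backward connectivity as an induction principle: a property is carried from [top] to all cells
    along sources. *)
Definition generates k (L : network k) (top : L) : Prop :=
  forall P : L -> Prop, P top -> (forall i d, P d -> P (src i d)) ->
  forall c, P c.

Lemma backward_connected_generates k (L : network k) :
  backward_connected L -> exists top : L, generates top.
Proof.
move=> [top htop]; exists top => P Ptop Psrc c.
have : connect (@edge k L) c top.
  by have [->|/htop //] := eqVneq c top; exact: connect0.
move=> /connectP[s]; elim: s c => [c _ topE|d s IH c /= /andP[cd pds] topE].
  by rewrite -[c]topE.
by have /existsP[i /eqP <-] := cd; apply: Psrc; exact: IH.
Qed.

(** The truncated predecessor also covers the first layer, whose cells are their own sources. *)
Lemma lay_src k (N : network k) m (lay : N -> nat) i c :
  feed_forward m lay -> lay (src i c) = (lay c).-1.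
Proof.
move=> hN; case layE: (lay c) => [|j] /=; first by rewrite (ff_first hN).
exact: (ff_next hN).
Qed.

Section LayersOfLift.
Variables (k : nat) (N L : network k) (m n : nat).
Variables (layN : N -> nat) (layL : L -> nat).
Hypotheses (hN : feed_forward m layN) (hL : feed_forward n layL).
Variables (top : L).
Hypothesis htop : generates top.

(** Passing to a source never raises the layer, so [top] lies in the highest one. *)
Lemma lay_top : layL top = n.
Proof.
apply/eqP; rewrite eqn_leq (ff_bound hL) /=.
have [c <-] := ff_nonempty hL (leqnn n).
move: c; apply: htop => // i d; rewrite (lay_src _ _ hL).
exact/leq_trans/leq_pred.
Qed.

Lemma lay_hom_top (p : L -> N) : surj_hom p -> layN (p top) = m.
Proof.
move=> [hom surj]; apply/eqP; rewrite eqn_leq (ff_bound hN) /=.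
have [y <-] := ff_nonempty hN (leqnn m).
have [c <-] := surj y; move: c; apply: htop => // i d.
by rewrite hom (lay_src _ _ hN); exact/leq_trans/leq_pred.
Qed.

(** Both sides agree at [top] and drop by one along sources, truncated at 0. The truncation is what
    sends the layers 0 to [n - m] of [L] into the first layer of [N]. *)
Lemma lay_hom (p : L -> N) c : (m <= n)%N -> surj_hom p ->
  layN (p c) = (layL c - (n - m))%N.
Proof.
move=> mn hp; move: c; apply: htop.
  by rewrite lay_hom_top // lay_top subKn.
move=> i d IH; rewrite hp.1 (lay_src _ _ hN) (lay_src _ _ hL) IH.
by rewrite -subn1 subnAC subn1.
Qed.

(** By surjectivity [q top], which lies in the layer [m], is some [p d]; but the only image under
    [p] in that layer is [p top]. So [p] and [q] agree at [top], hence everywhere. *)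
Lemma surj_hom_unique (p q : L -> N) : surj_hom p -> surj_hom q -> p =1 q.
Proof.
move=> hp hq.
have ptop d : layN (p d) = m -> p d = p top.
  move: d; apply: htop => // i d IH; rewrite hp.1 (lay_src _ _ hN).
  (* The image of a source can lie in the layer [m] only if [m = 0]; then the edges of [N] are
     self-loops and the induction hypothesis applies. *)
  have := ff_bound hN (p d); case layE: (layN (p d)) => [|j] /=.
    by move=> _ m0; rewrite (ff_first hN) //; apply: IH; rewrite layE.
  by move=> jm jE; move: jm; rewrite jE ltnn.
have [d dE] := hp.2 (q top).
apply: htop => [|i d' IH]; last by rewrite hp.1 hq.1 IH.
by rewrite -dE ptop// dE lay_hom_top.
Qed.

(** To reach [y] from the first layer, start at any preimage of [y] and follow sources down: the
    image stays [y], because of the self-loops at [y]. *)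
Lemma hom_first_layer (p : L -> N) : (m <= n)%N -> surj_hom p ->
  p @: layer layL 0 = layer layN 0.
Proof.
move=> mn hp; apply/setP => y; rewrite inE; apply/imsetP/eqP.
  by move=> [c]; rewrite inE => /eqP c0 ->; rewrite lay_hom// c0 sub0n.
move=> y0; have [c cE] := hp.2 y.
suff [e [e0 eE]] : exists e, layL e = 0%N /\ p e = y.
  by exists e; rewrite // inE e0.
move: {2}(layL c) (erefl (layL c)) => l; elim: l => [|l IH] in c cE *.
  by exists c.
move=> cl; have n0 : (0 < n)%N by rewrite (leq_trans _ (ff_bound hL c)) ?cl.
(* A first-layer cell below another layer is the source of some edge, which supplies the edge type
   [i] for the descent. *)
have [e e0] := ff_nonempty hL (leq0n n).
have [i _] := ff_onto hL n0 e0.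
apply: (IH (src i c)); last by rewrite (lay_src _ _ hL) cl.
by rewrite hp.1 cE (ff_first hN).
Qed.

Lemma first_layer_inj (p : L -> N) : (m <= n)%N -> surj_hom p ->
  #|layer layL 0| = #|layer layN 0| <-> {in layer layL 0 &, injective p}.
Proof.
move=> mn hp; rewrite -(hom_first_layer mn hp).
by split=> [/esym/eqP/imset_injP|/imset_injP/eqP/esym].
Qed.

(** Induction on the sum of the two layers, since cells with the same image may lie in different
    layers: a cell already in the first layer stays put while the other one descends. *)
Lemma eq_fibers_from_first_layer (p : L -> N) (T : Type) (x : L -> T) :
  network_hom p -> {in layer layL 0 &, injective p} ->
  (forall c d, 'I_k -> (forall i, x (src i c) = x (src i d)) -> x c = x d) ->
  forall c d, p c = p d -> x c = x d.
Proof.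
move=> hom inj xsrc c d; move: {2}(layL c + layL d)%N (leqnn (layL c + layL d)).
move=> s; elim: s => [|s IH] in c d *.
  rewrite leqn0 addn_eq0 => /andP[/eqP c0 /eqP d0] pE.
  by rewrite (inj c d) // inE ?c0 ?d0.
have [/eqP|] := posnP (layL c + layL d)%N.
  rewrite addn_eq0 => /andP[/eqP c0 /eqP d0] _ pE.
  by rewrite (inj c d) // inE ?c0 ?d0.
move=> gt0 les pE; have n0 : (0 < n)%N.
  have := leq_add (ff_bound hL c) (ff_bound hL d); case: (n) => //.
  by rewrite leqNgt gt0.
have [e e0] := ff_nonempty hL (leq0n n).
have [i0 _] := ff_onto hL n0 e0.
apply: xsrc => // i; apply: IH; last by rewrite !hom pE.
rewrite !(lay_src _ _ hL); move: gt0 les.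
case: (layL c) => [|a]; case: (layL d) => [|b] //=;
  rewrite ?addn0 ?addnS ?addSn ?ltnS //.
by move=> _ /ltnW.
Qed.

End LayersOfLift.

(** * Smooth functions and curves *)

Section SmoothFunctions.
Variables (R : realType) (n : nat).
Implicit Types (f g : 'rV[R]_n -> R) (x v : 'rV[R]_n).

Lemma smooth_differentiable f x : smooth f -> differentiable f x.
Proof. by move=> /(_ [::] x). Qed.

Lemma smooth_partial f i : smooth f -> smooth (partial i f).
Proof. by move=> fs s x; have := fs (rcons s i) x; rewrite foldr_rcons. Qed.

Lemma smooth_continuous f : smooth f -> continuous f.
Proof.
by move=> fs x; apply: differentiable_continuous; exact: smooth_differentiable.
Qed.

(** Iterated partial derivatives never leave [P]; smoothness is thus proved by exhibiting a class
    closed under differentiation. *)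
Lemma smooth_coind (P : set ('rV[R]_n -> R)) :
  (forall f, P f ->
    (forall x, differentiable f x) /\ forall i, P (partial i f)) ->
  forall f, P f -> smooth f.
Proof.
move=> PP f Pf s x; have : P (foldr (@partial R n) f s).
  by elim: s => //= i s /PP[_]; exact.
by move=> /PP[].
Qed.

Lemma is_derive_partial f x v : differentiable f x ->
  is_derive x v f (\sum_i v 0 i * partial i f x).
Proof.
move=> df; apply: DeriveDef; first exact: diff_derivable.
rewrite deriveE// {1}(row_sum_delta v) linear_sum; apply: eq_bigr => i _.
by rewrite linearZ /partial deriveE.
Qed.

(** Derivatives of products are sums of products, so both operations are closed off together before
    [smooth_coind] is applied. *)
Inductive smooth_alg : ('rV[R]_n -> R) -> Prop :=
| SmoothAlg f : smooth f -> smooth_alg f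
| SmoothAlgD f g : smooth_alg f -> smooth_alg g -> smooth_alg (f + g)
| SmoothAlgM f g : smooth_alg f -> smooth_alg g -> smooth_alg (f * g).

Lemma smooth_alg_smooth f : smooth_alg f -> smooth f.
Proof.
apply: smooth_coind => {}f; elim=> {}f => [fs|g fa [df pf] ga [dg pg]|].
- by split=> [x|i]; [|constructor; exact: smooth_partial];
    exact: smooth_differentiable.
- split=> [x|i]; first exact: differentiableD.
  rewrite (_ : partial i (f + g) = partial i f + partial i g).
    exact: SmoothAlgD.
  by apply/funext => x; rewrite /partial deriveD//; exact: diff_derivable.
- move=> g fa [df pf] ga [dg pg]; split=> [x|i]; first exact: differentiableM.
  rewrite (_ : partial i (f * g) = f * partial i g + g * partial i f).
    by apply: SmoothAlgD; exact: SmoothAlgM.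
  by apply/funext => x; rewrite /partial deriveM//; exact: diff_derivable.
Qed.

Lemma smoothD f g : smooth f -> smooth g -> smooth (f + g).
Proof.
by move=> fs gs; apply/smooth_alg_smooth/SmoothAlgD; exact: SmoothAlg.
Qed.

Lemma smoothM f g : smooth f -> smooth g -> smooth (f * g).
Proof.
by move=> fs gs; apply/smooth_alg_smooth/SmoothAlgM; exact: SmoothAlg.
Qed.

Lemma partialD i f g : smooth f -> smooth g ->
  partial i (f + g) = partial i f + partial i g.
Proof.
move=> fs gs; apply/funext => x; rewrite /partial deriveD//;
  exact/diff_derivable/smooth_differentiable.
Qed.

Lemma partialM i f g : smooth f -> smooth g ->
  partial i (f * g) = f * partial i g + g * partial i f.
Proof.
move=> fs gs; apply/funext => x; rewrite /partial deriveM//;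
  exact/diff_derivable/smooth_differentiable.
Qed.

Lemma partial_cst i (a : R) : partial i (cst a : 'rV[R]_n -> R) = 0.
Proof. by apply/funext => x; rewrite /partial derive_cst. Qed.

Lemma smooth_cst (a : R) : smooth (cst a : 'rV[R]_n -> R).
Proof.
apply: (@smooth_coind [set f | exists a, f = cst a]) => [_ [{}a ->]|];
  last by exists a.
by split=> [x|i]; [exact: differentiable_cst | exists 0; exact: partial_cst].
Qed.

Lemma smooth_sum (I : Type) (r : seq I) (P : pred I) (F : I -> 'rV[R]_n -> R) :
  (forall i, P i -> smooth (F i)) -> smooth (\sum_(i <- r | P i) F i).
Proof.
by move=> Fs; elim/big_ind : _ => //; [exact: smooth_cst|exact: smoothD].
Qed.

Definition coordf (j : 'I_n) : 'rV[R]_n -> R := fun x => x 0 j.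

Lemma partial_coordf i j : partial i (coordf j) = cst (i == j)%:R.
Proof.
apply/funext => x; rewrite /partial /coordf.
have /deriveE -> := @differentiable_coord R 1 n x 0 j.
have @l : {linear 'rV[R]_n -> R}.
  by exists (coordf j); do 2![eexists]; do ?[constructor];
     rewrite /coordf ?mxE// => ? *; rewrite ?mxE//; move=> ?; rewrite !mxE.
rewrite -[(fun N : 'rV_n => _)]/(l : _ -> _) diff_lin; last exact: coord_continuous.
by rewrite /= /coordf mxE eqxx eq_sym.
Qed.

Lemma smooth_coordf j : smooth (coordf j).
Proof.
apply: (@smooth_coind (coordf j |` [set f | exists a, f = cst a]));
  last by left.
move=> f [->|[a ->]].
  split=> [x|i]; first exact: differentiable_coord.
  by right; rewrite partial_coordf; eexists.
split=> [x|i]; first exact: differentiable_cst.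
by right; exists 0; exact: partial_cst.
Qed.

End SmoothFunctions.

Arguments smooth_partial {R n f} i _ _ _.
Arguments smoothD {R n f g} _ _ _ _.
Arguments smoothM {R n f g} _ _ _ _.
Arguments smooth_cst {R} n a _ _.
Arguments smooth_coordf R {n} j _ _.

(** * Finite orders of differentiability on an open subset of the line *)

Section NDerivable.
Variables (R : realType) (A : set R).
Hypothesis oA : open A.
Implicit Types (g h dg : R -> R).

(** A finite-order version of [smooth_on], so that regularity can be gained one order at a time. *)
Definition nderivable n g : Prop :=
  forall j, (j < n)%N -> forall t, A t -> derivable (g^`(j)) t 1.

Lemma smooth_onP g : smooth_on A g <-> forall n, nderivable n g.
Proof.
split=> [gA n j _ t At|gA n t At]; first exact: gA.
exact: (gA n.+1 n).
Qed.

Lemma eq_derive1n_in g h n : {in A, g =1 h} -> {in A, g^`(n) =1 h^`(n)}.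
Proof.
move=> gh; elim: n => [//|n IH] t At; rewrite !derive1nS !derive1E.
apply: near_eq_derive; near=> s; apply: IH.
near: s; rewrite inE in At; have := open_nbhs_nbhs (conj oA At).
by apply: filterS => s; rewrite inE.
Unshelve. all: by end_near. Qed.

Lemma eq_nderivable n g h :
  {in A, g =1 h} -> nderivable n g -> nderivable n h.
Proof.
move=> gh gA j jn t At; apply: near_eq_derivable (gA j jn t At).
have := open_nbhs_nbhs (conj oA At); apply: filterS => s As.
by apply: eq_derive1n_in => //; rewrite inE.
Qed.

Lemma nderivable_leq m n g : (m <= n)%N -> nderivable n g -> nderivable m g.
Proof. by move=> mn gA j jm; apply: gA; exact: leq_trans mn. Qed.

(** The derivative is known on [A] only; as [A] is open, this still determines the higher
    derivatives there. *)
Lemma nderivableS n g dg : (forall t, A t -> is_derive t 1 g (dg t)) ->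
  nderivable n dg -> nderivable n.+1 g.
Proof.
move=> gdg dgA [_ t /gdg|j jn]; first by [].
rewrite /derive1n iterSr -/(derive1n j g^`()) => t At.
apply: (eq_nderivable _ dgA) jn t At => t /set_mem At.
by rewrite derive1E; have /gdg ? := At; rewrite derive_val.
Qed.

Lemma nderivable_derive1 n g : nderivable n.+1 g -> nderivable n g^`().
Proof.
move=> gA j jn t At; have := gA j.+1 jn t At.
by rewrite /derive1n iterSr.
Qed.

Lemma nderivable_is_derive n g t : nderivable n.+1 g -> A t ->
  is_derive t 1 g (g^`() t).
Proof. by move=> /(_ 0%N erefl t) gA /gA; rewrite derive1E => /derivableP. Qed.

Lemma nderivable0 g : nderivable 0 g.
Proof. by move=> j; rewrite ltn0. Qed.

Lemma nderivable_cst n (a : R) : nderivable n (cst a).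
Proof.
by elim: n a => [//|n IH] a; exact: (@nderivableS _ _ (cst 0)).
Qed.

Lemma nderivable_id n : nderivable n id.
Proof.
case: n => [//|n]; apply: (@nderivableS _ _ (cst 1)).
exact: nderivable_cst.
Qed.

Lemma nderivableD n g h :
  nderivable n g -> nderivable n h -> nderivable n (g + h).
Proof.
elim: n g h => [|n IH] g h gA hA; first exact: nderivable0.
apply: (@nderivableS _ _ (derive1 g + derive1 h)) => [t At|].
  have dg := nderivable_is_derive gA At; have dh := nderivable_is_derive hA At.
  exact: (is_deriveD dg dh).
exact: IH (nderivable_derive1 gA) (nderivable_derive1 hA).
Qed.

Lemma nderivableM n g h :
  nderivable n g -> nderivable n h -> nderivable n (g * h).
Proof.
elim: n g h => [|n IH] g h gA hA; first exact: nderivable0.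
apply: (@nderivableS _ _ (g * derive1 h + h * derive1 g)) => [t At|].
  have dg := nderivable_is_derive gA At; have dh := nderivable_is_derive hA At.
  exact: (is_deriveM dg dh).
have [gA' hA'] := (nderivable_leq (leqnSn n) gA, nderivable_leq (leqnSn n) hA).
exact: nderivableD (IH _ _ gA' (nderivable_derive1 hA))
                   (IH _ _ hA' (nderivable_derive1 gA)).
Qed.

Lemma nderivableV n g : (forall t, A t -> g t != 0) ->
  nderivable n g -> nderivable n (fun t => (g t)^-1).
Proof.
move=> g0; elim: n => [|n IH] gA; first exact: nderivable0.
pose gV t := (g t)^-1.
apply: (@nderivableS _ _ (cst (-1) * (gV * gV * derive1 g))) => [t At|].
  apply: is_derive_eq.
    exact: is_deriveV (g0 t At) (nderivable_is_derive gA At).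
  rewrite !fctE /gV.
  by rewrite expr2 invfM scaleNr mulN1r.
have gVA : nderivable n gV := IH (nderivable_leq (leqnSn n) gA).
have cA : nderivable n (cst (-1) : R -> R) := @nderivable_cst n _.
apply: (nderivableM cA).
exact: (nderivableM (nderivableM gVA gVA) (nderivable_derive1 gA)).
Qed.

Lemma nderivable_sum n (I : Type) (r : seq I) (P : pred I) (F : I -> R -> R) :
  (forall i, P i -> nderivable n (F i)) -> nderivable n (\sum_(i <- r | P i) F i).
Proof.
move=> FA; elim/big_ind : _ => [|g h|]; last exact: FA.
  exact: nderivable_cst.
exact: nderivableD.
Qed.

End NDerivable.

Arguments nderivable_cst {R A} oA n a _ _ _ _.
Arguments nderivableM {R A} oA {n g h} _ _ _ _ _ _.
Arguments nderivableD {R A} oA {n g h} _ _ _ _ _ _.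
Arguments nderivable_derive1 {R A n g} _ _ _ _ _.
Arguments nderivable_leq {R A m n g} _ _ _ _ _ _.

Section Curves.
Variables (R : realType) (n : nat).
Implicit Types (f : 'rV[R]_n -> R) (z : R -> 'rV[R]_n).

Lemma is_derive_comp_curve f z t (dz : 'I_n -> R) : differentiable f (z t) ->
  (forall i, is_derive t 1 (fun s => z s 0 i) (dz i)) ->
  is_derive t 1 (f \o z) (\sum_i dz i * partial i f (z t)).
Proof.
move=> df dzt; have zt : derivable z t 1.
  by apply/derivable_mxP => i j; rewrite ord1.
have zd : differentiable z t by exact/derivable1_diffP.
apply: DeriveDef; first exact/derivable1_diffP/differentiable_comp.
rewrite deriveE; last exact: differentiable_comp.
rewrite diff_comp//= -!deriveE// derive_mx//.
have df' := is_derive_partial (\matrix_(i < 1, j < n) 'D_1 (fun s => z s i j) t) df.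
rewrite derive_val; apply: eq_bigr => i _; rewrite mxE.
by have ? := dzt i; rewrite derive_val.
Qed.

Lemma nderivable_comp (A : set R) m f z : open A -> smooth f ->
  (forall i, nderivable A m (fun s => z s 0 i)) -> nderivable A m (f \o z).
Proof.
move=> oA; elim: m f => [|m IH] f fs zA; first exact: nderivable0.
apply: (@nderivableS _ _ oA _ _
  (\sum_i derive1 (fun s => z s 0 i) * (partial i f \o z))) => [t At|].
  rewrite fct_sumE; apply: is_derive_comp_curve.
    exact: smooth_differentiable.
  by move=> i; exact: nderivable_is_derive (zA i) At.
apply: (nderivable_sum oA) => i _.
apply: (nderivableM oA (nderivable_derive1 (zA i))).
apply: (IH _ (smooth_partial i fs)) => j.
exact: nderivable_leq (leqnSn _) (zA j).
Qed.

End Curves.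

Arguments nderivable_comp {R n A m f z} oA _ _ _ _ _ _.

(** * Implicitly defined curves *)

Section Lines.
Variables (R : realType).

Definition dird n (v : 'rV[R]_n) (f : 'rV[R]_n -> R) : 'rV[R]_n -> R :=
  fun x => \sum_i v 0 i * partial i f x.

Lemma smooth_dird n (v : 'rV[R]_n) f : smooth f -> smooth (dird v f).
Proof.
move=> fs; rewrite (_ : dird v f = \sum_i cst (v 0 i) * partial i f); last first.
  by apply/funext => x; rewrite fct_sumE.
by apply: smooth_sum => i _; exact: (smoothM (smooth_cst _ _) (smooth_partial _ fs)).
Qed.

Arguments smooth_dird {n} v {f} _ _ _.

Lemma is_derive_line n (f : 'rV[R]_n -> R) (w v : 'rV[R]_n) (s : R) : smooth f ->
  is_derive s 1 (fun s : R => f (w + s *: v)) (dird v f (w + s *: v)).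
Proof.
move=> fs; apply: (@is_derive_comp_curve _ _ f (fun s => w + s *: v)).
  exact: smooth_differentiable.
move=> i; rewrite (_ : (fun _ => _) = cst (w 0 i) + id * cst (v 0 i)).
  apply: is_derive_eq (is_deriveD (is_derive_cst (w 0 i) s 1)
    (is_deriveM (is_derive_id s 1) (is_derive_cst (v 0 i) s 1))) _.
  by rewrite scaler0 !add0r; exact: mulr1.
by apply/funext => u; rewrite !mxE.
Qed.

Lemma mean_value (F dF : R -> R) (a b : R) : (forall s : R, is_derive s 1 F (dF s)) ->
  exists2 xi, (a <= xi <= b) || (b <= xi <= a) & F b - F a = dF xi * (b - a).
Proof.
wlog ab : a b / a <= b => [wl dFE|dFE].
  have [|/ltW ba] := leP a b; first by move=> /wl; exact.
  have [xi xiab E] := wl b a ba dFE; exists xi; first by rewrite orbC.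
  by rewrite -opprB E -mulrN opprB.
have [xi xiab E] := @MVT_segment R F dF a b ab (fun s _ => dFE s)
  (derivable_within_continuous (fun s _ => @ex_derive _ _ _ _ _ _ _ (dFE s))).
by exists xi => //; move: xiab; rewrite in_itv /= => ->.
Qed.

(** Mean value theorem: the derivative has absolute value at least [|c| / 2] between [s] and [t]. *)
Lemma inverse_lipschitz (F dF : R -> R) (p c r s t : R) :
  (forall s : R, is_derive s 1 F (dF s)) ->
  (forall s, `|s - p| <= r -> `|dF s - c| <= `|c| / 2) ->
  `|s - p| <= r -> `|t - p| <= r ->
  `|c| / 2 * `|s - t| <= `|F s - F t|.
Proof.
move=> dFE dFc sr tr; have [xi xist ->] := mean_value t s dFE.
rewrite normrM ler_wpM2r//.
have /dFc : `|xi - p| <= r.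
  by move: sr tr; rewrite !ler_norml; case/orP: xist => /andP[]; lra.
have := ler_distD (dF xi) c 0; rewrite !subr0 (distrC c); lra.
Qed.

(** A slope of size at least [|c| / 2] over the length [r] on either side of [p] outweighs [F p], so
    [F] changes sign. *)
Lemma root_exists (F dF : R -> R) (p c r : R) :
  (forall s : R, is_derive s 1 F (dF s)) ->
  (forall s, `|s - p| <= r -> `|dF s - c| <= `|c| / 2) ->
  0 < r -> `|F p| <= `|c| / 2 * r ->
  exists2 s, `|s - p| <= r & F s = 0.
Proof.
move=> dFE dFc r0 Fp.
wlog c0 : F dF c dFE dFc Fp / 0 <= c => [wl|].
  have [|/ltW c0] := leP 0 c; first exact: (wl F dF).
  have [|||s sp Fs0] := wl (- F) (- dF) (- c).
  - by move=> s /dFc; rewrite normrN fctE -opprD normrN.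
  - by rewrite !normrN.
  - by rewrite oppr_ge0.
  - by exists s => //; apply/eqP; rewrite -oppr_eq0; apply/eqP.
rewrite (ger0_norm c0) in Fp dFc.
have dFge s : `|s - p| <= r -> c / 2 <= dF s.
  by move=> /dFc; rewrite ler_norml; lra.
have [xi xiP E] := mean_value p (p + r) dFE.
have [xj xjP E'] := mean_value (p - r) p dFE.
have xi_ge : c / 2 <= dF xi.
  by apply: dFge; rewrite ler_norml; case/orP: xiP => /andP[]; lra.
have xj_ge : c / 2 <= dF xj.
  by apply: dFge; rewrite ler_norml; case/orP: xjP => /andP[]; lra.
have Fpos : 0 <= F (p + r).
  have -> : F (p + r) = F p + dF xi * r by move: E; lra.
  have : c / 2 * r <= dF xi * r by rewrite ler_wpM2r// ltW.
  by move: Fp; rewrite ler_norml; lra.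
have Fneg : F (p - r) <= 0.
  have -> : F (p - r) = F p - dF xj * r by move: E'; lra.
  have : c / 2 * r <= dF xj * r by rewrite ler_wpM2r// ltW.
  by move: Fp; rewrite ler_norml; lra.
have [|||s sP Fs0] := @IVT R F (p - r) (p + r) 0.
- lra.
- by apply: derivable_within_continuous => s _; have := dFE s.
- by rewrite ge_min le_max Fpos Fneg orbT.
by exists s => //; move: sP; rewrite in_itv /= ler_norml; lra.
Qed.

End Lines.

Arguments smooth_dird {R n} v {f} _ _ _.

Section ImplicitCurve.
Variables (R : realType) (n : nat) (f : 'rV[R]_n -> R) (v : 'rV[R]_n).
Variables (w : R -> 'rV[R]_n) (x : R -> R).
Hypothesis fs : smooth f.

(** A general direction [v] serves two equations: the first coordinate vector when the state of one
    cell is solved for, the diagonal for the first layer. *)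
Let z s : 'rV[R]_n := w s + x s *: v.

(** As [s] tends to [t], [f (w s + x t *: v)] tends to [f (z t) = 0], and it dominates
    [|x t - x s|]. *)
Lemma implicit_continuous (t kappa : R) : 0 < kappa ->
  {for t, continuous w} -> f (z t) = 0 ->
  (\forall s \near t, kappa * `|x t - x s| <= `|f (w s + x t *: v)|) ->
  {for t, continuous x}.
Proof.
move=> k0 wt fzt near_t.
have lim : `|f (w s + x t *: v)| @[s --> t] --> (0 : R).
  rewrite -(normr0 R) -fzt; apply: cvg_norm.
  apply: (@cvg_comp _ _ _ (fun s => w s + x t *: v) f _ (nbhs (z t))).
    by apply: cvgD wt _; exact: cvg_cst.
  exact: smooth_continuous.
apply/cvgrPdist_le => e e0.
have /cvgrPdist_le/(_ _ (mulr_gt0 k0 e0)) lim_e := lim.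
near=> s; rewrite -(ler_pM2l k0); apply: (le_trans (near near_t s _)) => //.
have -> : `|f (w s + x t *: v)| = `|0 - `|f (w s + x t *: v)| |.
  by rewrite sub0r normrN normr_id.
by near: s.
Unshelve. all: by end_near. Qed.

(** The mean value theorem along [v] gives [xi s] between [x t] and [x s]. As [f] vanishes on the
    curve, the difference quotient of [x] is minus that of [f (w s + x t *: v)], divided by the
    derivative along [v] at [xi s], and both converge. *)
Lemma implicit_is_derive (t : R) (dw : 'I_n -> R) :
  (forall i, is_derive t 1 (fun s => w s 0 i) (dw i)) ->
  {for t, continuous x} -> (\forall s \near t, f (z s) = 0) ->
  dird v f (z t) != 0 ->
  is_derive t 1 x (- (\sum_i dw i * partial i f (z t)) / dird v f (z t)).
Proof.
move=> wdw xt fz D0.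
have /boolp.choice[xi xiP] : forall s, exists u,
    `|u - x t| <= `|x s - x t| /\
    f (z s) - f (w s + x t *: v) = dird v f (w s + u *: v) * (x s - x t).
  move=> s.
  have [u uP E] := mean_value (x t) (x s) (fun u => is_derive_line (w s) v u fs).
  exists u; split=> //; case/orP: uP => /andP[a b].
    by rewrite !ger0_norm; lra.
  by rewrite !ler0_norm; lra.
have wt : {for t, continuous w}.
  apply/differentiable_continuous/derivable1_diffP/derivable_mxP => i j.
  by rewrite ord1.
have xit : xi s @[s --> t] --> x t.
  have /cvgrPdist_le xt' := xt; apply/cvgrPdist_le => e /xt'.
  apply: filterS => s; rewrite !(distrC (x t)); apply: le_trans.
  by have [] := xiP s.
have Dt : dird v f (w s + xi s *: v) @[s --> t] --> dird v f (z t).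
  apply: (@cvg_comp _ _ _ (fun s => w s + xi s *: v) (dird v f) _ (nbhs (z t))).
    by apply: cvgD wt _; apply: cvgZr_tmp.
  exact/smooth_continuous/smooth_dird.
pose G s := f (w s + x t *: v).
have dG : is_derive t 1 G (\sum_i dw i * partial i f (z t)).
  apply: (@is_derive_comp_curve _ _ f (fun s => w s + x t *: v)).
    exact: smooth_differentiable.
  move=> i; rewrite (_ : (fun _ => _) = (fun s => w s 0 i) + cst (x t * v 0 i)).
    by apply: is_derive_eq (is_deriveD (wdw i) (is_derive_cst _ _ _)) _;
      rewrite addr0.
  by apply/funext => u; rewrite !mxE.
have G0 : G t = 0 by exact: (nbhs_singleton fz).
have sh : (h *: 1 + t) @[h --> (0 : R)^'] --> t.
  rewrite -[X in _ --> X]add0r -[X in X + _](scale0r (1 : R)).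
  by apply: cvgD; [apply: cvgZr_tmp; exact: nbhs_dnbhs|exact: cvg_cst].
suff lim : h^-1 *: (x (h *: 1 + t) - x t) @[h --> 0^'] -->
    - (\sum_i dw i * partial i f (z t)) / dird v f (z t).
  by apply: DeriveDef; [apply/cvg_ex; eexists; exact: lim | exact: cvg_lim].
have limG : h^-1 *: (G (h *: 1 + t) - G t) @[h --> 0^'] -->
    \sum_i dw i * partial i f (z t).
  by rewrite -(@derive_val _ _ _ _ _ _ _ dG); exact: (@ex_derive _ _ _ _ _ _ _ dG).
have limD : (dird v f (w (h *: 1 + t) + xi (h *: 1 + t) *: v))^-1 @[h --> 0^']
    --> (dird v f (z t))^-1.
  by apply: cvgV => //; apply: (@cvg_comp _ _ _ (fun h => h *: 1 + t)
    (fun s => dird v f (w s + xi s *: v)) _ (nbhs t)).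
have nearD : \forall s \near t, dird v f (w s + xi s *: v) != 0.
  exact: (Dt _ (open_nbhs_nbhs (conj (@open_neq R 0) D0))).
have shD : \forall h \near 0^', (fun s => dird v f (w s + xi s *: v) != 0)
  (h *: 1 + t) := sh _ nearD.
have shf : \forall h \near 0^', (fun s => f (z s) = 0) (h *: 1 + t) := sh _ fz.
apply: cvg_trans (cvgM (cvgN limG) limD).
apply: near_eq_cvg; near=> h.
have fs0 : f (z (h *: 1 + t)) = 0 by exact: (near shf h).
have Ds0 : dird v f (w (h *: 1 + t) + xi (h *: 1 + t) *: v) != 0.
  by exact: (near shD h).
move: fs0 Ds0; set s := h *: 1 + t => fs0 Ds0.
transitivity (- (h^-1 *: (G s - G t)) / dird v f (w s + xi s *: v)) => //.
rewrite G0 subr0 -/s; have [_] := xiP s.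
rewrite fs0 sub0r -/(G s) => /(congr1 -%R); rewrite opprK => ->.
by rewrite /GRing.scale /=; move: (h^-1) => u; field.
Unshelve. all: by end_near. Qed.

(** Bootstrap: the formula for the derivative of [x] involves only [x] and smooth data, so each
    order of differentiability gives the next. *)
Lemma implicit_smooth (A : set R) : open A ->
  (forall i, smooth_on A (fun s => w s 0 i)) ->
  (forall t, A t -> [/\ {for t, continuous x}, f (z t) = 0 &
    dird v f (z t) != 0]) ->
  smooth_on A x.
Proof.
move=> oA wA xA; apply/smooth_onP => m.
elim: m => [|m IH]; first exact: nderivable0.
apply: (@nderivableS _ _ oA _ _ (cst (-1) *
  (\sum_i derive1 (fun s => w s 0 i) * (partial i f \o z)) *
  (fun s => ((dird v f \o z) s)^-1))) => [t At|].
  have [xt fzt Dt] := xA t At.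
  apply: is_derive_eq; first apply: (@implicit_is_derive t
    (fun i => derive1 (fun s => w s 0 i) t)) => //.
    move=> i; have /smooth_onP/(_ 1%N) wi := wA i.
    exact: (nderivable_is_derive wi At).
    have := open_nbhs_nbhs (conj oA At); apply: filterS => s As.
    by have [] := xA s As.
  by rewrite mulN1r fct_sumE.
have wAm i : nderivable A m.+1 (fun s => w s 0 i).
  by have /smooth_onP := wA i; exact.
have zA i : nderivable A m (fun s => z s 0 i).
  rewrite (_ : (fun _ => _) = (fun s => w s 0 i) + x * cst (v 0 i)).
    apply: (nderivableD oA (nderivable_leq (leqnSn m) (wAm i))).
    exact: (nderivableM oA IH (nderivable_cst oA _ _)).
  by apply/funext => s; rewrite !mxE.
have cA : nderivable A m (cst (-1) : R -> R) := nderivable_cst oA _ _.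
apply: (nderivableM oA).
  apply: (nderivableM oA cA); apply: (nderivable_sum oA) => i _.
  apply: (nderivableM oA (nderivable_derive1 (wAm i))).
  exact: (nderivable_comp oA (smooth_partial _ fs) zA).
apply: (nderivableV oA) => [t At|]; first by have [] := xA t At.
exact: (nderivable_comp oA (smooth_dird _ fs) zA).
Qed.

End ImplicitCurve.

(** * Germs of branches *)

Section Germs.
Variables (R : realType).

(** Supplies a test point on the side of [s] and no farther from 0, hence inside any branch domain
    containing [s]. *)
Lemma near0_dir (P : R -> Prop) (s : R) : s != 0 -> (\forall t \near 0, P t) ->
  exists a : R, [/\ 0 < a, a <= 1 & P (a * s)].
Proof.
move=> s0 /nbhs_ballP[e /= e0 eP].
have s_gt0 : 0 < `|s| by rewrite normr_gt0.
exists (Num.min 1 (e / 2 / `|s|)); split.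
- by rewrite lt_min ltr01 !divr_gt0.
- by rewrite ge_min lexx.
- apply: eP; rewrite /ball /= sub0r normrN normrM ger0_norm; last first.
    by rewrite le_min ler01 !divr_ge0// ltW.
  have : Num.min 1 (e / 2 / `|s|) * `|s| <= e / 2.
    by rewrite -ler_pdivlMr// ge_min lexx orbT.
  lra.
Qed.

(** The bound at one point on the side of [s] keeps the derivative at 0 away from zero, and the
    derivative controls both sides. *)
Lemma one_sided_slope (u : R -> R) (s e : R) : 0 < e -> s != 0 -> u 0 = 0 ->
  derivable u 0 1 ->
  (\forall t \near 0, 0 <= t * s -> e * `|t| <= `|u t|) ->
  \forall t \near 0, e / 2 * `|t| <= `|u t|.
Proof.
move=> e0 s0 u0 du one.
(* Two losses of [e / 4], one in passing to the derivative and one in coming back, leave [e / 2]. *)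
have e4 : 0 < e / 4 by lra.
have slope : \forall t \near 0, t != 0 -> `|'D_1 u 0 - u t / t| <= e / 4.
  have /cvgrPdist_le/(_ _ e4) := du; rewrite near_withinE.
  apply: filterS => t + t0 => /(_ t0).
  have -> : u t / t = t^-1 *: ((u \o shift 0) (t *: 1) - u 0).
    by rewrite /= u0 subr0 addr0 [t *: 1]mulr1 mulrC.
  by [].
have utE t : t != 0 -> `|u t| = `|u t / t| * `|t|.
  by move=> t0; rewrite -normrM divfK.
have De : e * 3 / 4 <= `|'D_1 u 0|.
  have [a [a0 _ [ae sl]]] := near0_dir s0 (filterI one slope).
  have as0 : a * s != 0 by rewrite mulf_neq0// gt_eqF.
  have /ae : 0 <= a * s * s by rewrite -mulrA mulr_ge0 ?(ltW a0)// -expr2 sqr_ge0.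
  move: (sl as0); rewrite utE// ler_pM2r ?normr_gt0//.
  have := ler_distD 0 (u (a * s) / (a * s)) ('D_1 u 0).
  have := lerB_dist (u (a * s) / (a * s)) ('D_1 u 0).
  rewrite (distrC ('D_1 u 0)); lra.
apply: filterS slope => t.
have [-> _|t0 /(_ isT) h] := eqVneq t 0; first by rewrite normr0 mulr0.
rewrite utE// ler_wpM2r//.
have := lerB_dist ('D_1 u 0) (u t / t); lra.
Qed.

Variables (k : nat) (L : network k).
Implicit Types b : branch R L.

Lemma dom_convex b (s t : R) : branch_regular b ->
  dom b s -> 0 <= t * s -> `|t| <= `|s| -> dom b t.
Proof.
move=> [l l0 reg].
have shape : [\/ dom b = `]- l, l[%classic, dom b = `]- l, 0]%classic |
    dom b = `[0, l[%classic].
  by case: reg => [[-> _]|[[->|->] _]]; [apply: Or31|apply: Or32|apply: Or33].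
have [s0|s0|->] := ltgtP s 0; last first.
- by rewrite normr0 normr_le0 => ? _ /eqP ->.
- move=> ds; rewrite pmulr_lge0// => t0; rewrite !ger0_norm ?(ltW s0)// => ts.
  by case: shape ds => ->; rewrite /= !in_itv /=; lra.
- move=> ds; rewrite nmulr_lge0// => t0; rewrite !ler0_norm ?(ltW s0)// => ts.
  by case: shape ds => ->; rewrite /= !in_itv /=; lra.
Qed.

Lemma dom_neq0 b : branch_regular b -> exists2 s, s != 0 & dom b s.
Proof.
move=> [l l0 reg].
case: reg => [[-> _]|[[->|->] _]];
  [exists (l / 2)|exists (- (l / 2))|exists (l / 2)];
  by rewrite ?oppr_eq0 ?gt_eqF ?divr_gt0//= in_itv /=; lra.
Qed.

Lemma dom0 b : branch_regular b -> dom b 0.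
Proof.
move=> breg; have [s _ ds] := dom_neq0 breg.
by apply: (dom_convex breg ds); rewrite ?mul0r ?normr0.
Qed.

Lemma dom_cases b : branch_regular b ->
  (forall c, derivable (b ^~ c) 0 1) \/
  (forall s t, dom b s -> dom b t -> 0 <= t * s).
Proof.
move=> breg; have b0 := dom0 breg.
case: breg => l l0 [[_ bs]|[bdom _]]; first by left=> c; exact: (bs c 0%N 0 b0).
right=> s t; case: bdom => ->; rewrite /= !in_itv /= => /andP[s1 s2] /andP[t1 t2].
  by rewrite mulr_le0.
by rewrite mulr_ge0.
Qed.

Lemma branch_small b (e : R) : branch_regular b -> (forall c, b 0 c = 0) ->
  0 < e -> \forall t \near 0, dom b t -> forall c, `|b t c| <= e.
Proof.
move=> breg b0 e0; have bd0 := dom0 breg.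
suff small c : \forall t \near 0, dom b t -> `|b t c| <= e.
  have /filter_forall small' := small.
  by apply: filterS small' => t bt dt c; exact: bt.
case: breg => l l0 [[_ bs]|[_ bs]].
  have /derivable1_diffP/differentiable_continuous : derivable (b ^~ c) 0 1 :=
    bs c 0%N 0 bd0.
  move=> /cvgrPdist_le/(_ _ e0); apply: filterS => t.
  by rewrite /= b0 sub0r normrN.
have [/subspace_continuousP/(_ 0 bd0) bc _] := bs c.
have {bc} : (b ^~ c) @ within (dom b) (nbhs 0) --> (0 : R).
  by rewrite -[X in _ --> X](b0 c).
move/cvgrPdist_le/(_ _ e0); rewrite near_withinE; apply: filterS => t + dt.
by move=> /(_ dt); rewrite sub0r normrN.
Qed.

(** A linear separation, not a mere inequality: it is visible in the derivative at 0 and so can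
    cross to the other side of 0. *)
Definition gap b (c d : L) : Prop :=
  exists2 e : R, 0 < e & \forall t \near 0, dom b t ->
    e * `|t| <= `|b t c - b t d|.

(** The branches agree near 0 on the side of a common point [s] other than 0. If [b2] is one-sided,
    its domain lies on that side; otherwise [b2] is differentiable at 0 and [one_sided_slope]
    applies. *)
Lemma gap_related (b1 b2 : branch R L) c d :
  branch_regular b1 -> branch_regular b2 -> (forall c, b2 0 c = 0) ->
  related b1 b2 -> gap b1 c d -> gap b2 c d.
Proof.
move=> reg1 reg2 b20 [U [oU U0 Udom Ueq]] [e e0 gap1].
have [s s0 [[Us D1s] D2s]] : exists2 s, s != 0 & (U `&` dom b1 `&` dom b2) s.
  apply: contra_notP Udom => /forall2NP noS; apply/seteqP; split=> t /=.
    by move=> Ut; have [/negP|] := noS t; rewrite ?negbK => // /eqP.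
  by move=> ->; split; [split=> //|]; exact: dom0.
have one : \forall t \near 0, 0 <= t * s -> e * `|t| <= `|b2 t c - b2 t d|.
  have ts : \forall t \near (0 : R), `|t| <= `|s|.
    by apply: nbhs0_le; rewrite normr_gt0.
  have Ut := open_nbhs_nbhs (conj oU U0).
  near=> t => ts0.
  have ts' : `|t| <= `|s| by near: t.
  have D1t := dom_convex reg1 D1s ts0 ts'.
  have D2t := dom_convex reg2 D2s ts0 ts'.
  have Ut' : U t by near: t.
  rewrite -!Ueq//; move: D1t; near: t; exact: gap1.
have [db2|sgn2] := dom_cases reg2; last first.
  exists e => //; apply: filterS one => t bt dt; apply: bt.
  exact: sgn2.
exists (e / 2); first by rewrite divr_gt0.
have u0 : b2 0 c - b2 0 d = 0 by rewrite !b20 subr0.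
have du : derivable (fun t => b2 t c - b2 t d) 0 1.
  exact: (derivableB (db2 c) (db2 d)).
by apply: filterS (one_sided_slope e0 s0 u0 du one) => t + _.
Unshelve. all: by end_near. Qed.

Lemma gap_germ_eq (f : 'rV[R]_k.+2 -> R) b1 b2 c d :
  germ_eq f b1 b2 -> gap b1 c d -> gap b2 c d.
Proof.
elim=> [{}b1 {}b2 [[reg1 _ _] [reg2 b20 _] rel]|]; first exact: gap_related.
by move=> {b1 b2}b1 b2 b3 _ IH1 _ IH2 /IH1/IH2.
Qed.

Lemma germ_eq_regular (f : 'rV[R]_k.+2 -> R) b1 b2 :
  germ_eq f b1 b2 -> branch_regular b2.
Proof. by elim=> [? ? [_ []]|]. Qed.

Lemma gap_neq b c d : branch_regular b -> gap b c d ->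
  ~ \forall t \near 0, dom b t -> b t c = b t d.
Proof.
move=> breg [e e0 gapb] eqb; have [s s0 ds] := dom_neq0 breg.
have [a [a0 a1 [ga eqa]]] := near0_dir s0 (filterI gapb eqb).
have das : dom b (a * s).
  apply: (dom_convex breg ds).
    by rewrite -mulrA mulr_ge0 ?(ltW a0)// -expr2 sqr_ge0.
  by rewrite normrM (ger0_norm (ltW a0)) ler_piMl.
have := ga das; rewrite (eqa das) subrr normr0 leNgt.
by rewrite mulr_gt0// normr_gt0 mulf_neq0// gt_eqF.
Qed.

End Germs.

(** * The vector field near the origin *)

Section Points.
Variables (R : realType) (k : nat).
Implicit Types (x l : R) (y : 'I_k -> R).

Lemma ord_coordP (P : 'I_k.+2 -> Prop) : P ord0 -> P ord_max ->
  (forall i, P (lift ord0 (lift ord_max i))) -> forall j, P j.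
Proof.
move=> P0 Pmax Pi j; have [j' ->|-> //] := unliftP ord0 j.
have [i -> //|->] := unliftP ord_max j'.
by rewrite (_ : lift ord0 ord_max = ord_max) //; exact: val_inj.
Qed.

Lemma input_ord0 x y l : input x y l 0 ord0 = x.
Proof. by rewrite mxE unlift_none. Qed.

Lemma input_max x y l : input x y l 0 ord_max = l.
Proof.
have -> : ord_max = lift ord0 ord_max :> 'I_k.+2 by exact: val_inj.
by rewrite mxE liftK unlift_none.
Qed.

Lemma input_lift x y l i : input x y l 0 (lift ord0 (lift ord_max i)) = y i.
Proof. by rewrite mxE !liftK. Qed.

Definition inputE := (input_ord0, input_max, input_lift).

Lemma input0 : input 0 (fun=> 0) 0 = 0 :> 'rV[R]_k.+2.
Proof. by apply/rowP; apply: ord_coordP => [||i]; rewrite inputE mxE. Qed.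

Lemma row_addZE n (u v : 'rV[R]_n) (a : R) j :
  (u + a *: v) 0 j = u 0 j + a * v 0 j.
Proof. by rewrite !mxE. Qed.

Lemma input_line x y l :
  input x y l = input 0 y l + x *: (delta_mx 0 ord0 : 'rV_k.+2).
Proof.
apply/rowP; apply: ord_coordP => [||i]; rewrite row_addZE !inputE mxE eqxx /=.
- by rewrite mulr1 add0r.
- by rewrite mulr0 addr0.
- by rewrite mulr0 addr0.
Qed.

(** The direction of the line [(x, ..., x, l)] with [l] fixed; the derivative of [f] along it at 0
    is the sum that vanishes in [Vk]. *)
Definition diag_dir : 'rV[R]_k.+2 := input 1 (fun=> 1) 0.

Lemma input_diagonal x l :
  input x (fun=> x) l = input 0 (fun=> 0) l + x *: diag_dir.
Proof.
by apply/rowP; apply: ord_coordP => [||i]; rewrite row_addZE !inputE;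
  rewrite ?mulr1 ?mulr0 ?add0r ?addr0.
Qed.

Lemma dird_ord0 (f : 'rV[R]_k.+2 -> R) :
  dird (delta_mx 0 ord0) f = partial ord0 f.
Proof.
apply/funext => x; rewrite /dird (bigD1 ord0)//= mxE !eqxx mul1r big1 ?addr0//.
by move=> j j0; rewrite mxE (negbTE j0) andbF mul0r.
Qed.

Lemma diag_dirE j : diag_dir 0 j = (j != ord_max)%:R.
Proof.
move: j; apply: ord_coordP => [||i]; rewrite /diag_dir inputE ?eqxx//.
by rewrite -val_eqE /= /bump /= leqNgt ltn_ord add0n add1n eqSS ltn_eqF.
Qed.

Lemma dird_diag (f : 'rV[R]_k.+2 -> R) (z : 'rV[R]_k.+2) :
  dird diag_dir f z = \sum_(j | j != ord_max) partial j f z.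
Proof.
rewrite /dird [RHS]big_mkcond /=; apply: eq_bigr => j _.
by rewrite diag_dirE; case: ifP => _; rewrite ?mul1r ?mul0r.
Qed.

Lemma is_derive_input (f : 'rV[R]_k.+2 -> R) y l (s : R) : smooth f ->
  is_derive s 1 (fun s : R => f (input s y l)) (partial ord0 f (input s y l)).
Proof.
move=> fs; have := is_derive_line (input 0 y l) (delta_mx 0 ord0) s fs.
rewrite dird_ord0 -input_line; congr is_derive.
by apply/funext => u; rewrite [in RHS]input_line.
Qed.

Lemma input_near0 (P : 'rV[R]_k.+2 -> Prop) : (\forall z \near (0 : 'rV[R]_k.+2), P z) ->
  exists2 r : R, 0 < r & forall x y l,
    `|x| <= r -> (forall i, `|y i| <= r) -> `|l| <= r -> P (input x y l).
Proof.
move=> /nbhs_ballP[e /= e0 eP]; exists (e / 2); first by rewrite divr_gt0.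
move=> x y l xr yr lr; apply: eP; have ee : e / 2 < e by lra.
rewrite -ball_normE /ball_ /= sub0r normrN [ltLHS]/Num.Def.normr /= mx_normrE.
apply: (@le_lt_trans _ _ (e / 2)) => //; apply: bigmax_le => [|[i j] _ /=].
  by rewrite divr_ge0// ltW.
by rewrite ord1; move: j; apply: ord_coordP => [||i']; rewrite inputE.
Qed.

Lemma local_bound (f : 'rV[R]_k.+2 -> R) : smooth f -> partial ord0 f 0 != 0 ->
  exists2 r : R, 0 < r & forall x y l,
    `|x| <= r -> (forall i, `|y i| <= r) -> `|l| <= r ->
    `|partial ord0 f (input x y l) - partial ord0 f 0| <= `|partial ord0 f 0| / 2.
Proof.
move=> fs c0; apply: (@input_near0
  (fun z => `|partial ord0 f z - partial ord0 f 0| <= `|partial ord0 f 0| / 2)).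
have c2 : 0 < `|partial ord0 f 0| / 2 by rewrite divr_gt0 ?normr_gt0.
have := smooth_continuous (smooth_partial ord0 fs) (x := 0).
move=> /cvgrPdist_le/(_ _ c2); apply: filterS => z.
by rewrite distrC.
Qed.

Lemma local_injectivity (f : 'rV[R]_k.+2 -> R) :
  smooth f -> partial ord0 f 0 != 0 ->
  exists2 r : R, 0 < r & forall x x' y l,
    `|x| <= r -> `|x'| <= r -> (forall i, `|y i| <= r) -> `|l| <= r ->
    f (input x y l) = f (input x' y l) -> x = x'.
Proof.
move=> fs c0; have [r r0 fr] := local_bound fs c0; exists r => //.
move=> x x' y l xr x'r yr lr fxx'.
have := @inverse_lipschitz R _ _ 0 (partial ord0 f 0) r x x'
  (fun s => is_derive_input y l s fs).
rewrite !subr0 fxx' subrr normr0 => h.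
have {h} : `|partial ord0 f 0| / 2 * `|x - x'| <= 0.
  by apply: h => // s; rewrite subr0 => sr; exact: fr.
rewrite pmulr_rle0 ?divr_gt0 ?normr_gt0// normr_le0 subr_eq0.
by move/eqP.
Qed.

End Points.

(** * Statement (i): equal states propagate from the first layer *)

Section Lifted.
Variables (R : realType) (k : nat) (N L : network k) (m n : nat).
Variables (layN : N -> nat) (layL : L -> nat).
Hypotheses (hN : feed_forward m layN) (hL : feed_forward n layL).
Hypotheses (liftNL : is_lift N L) (Lback : backward_connected L).
Hypothesis mn : (m <= n)%N.

Lemma equilibrium_lifted (f : 'rV[R]_k.+2 -> R) (b : branch R L) :
  smooth f -> partial ord0 f 0 != 0 -> #|layer layL 0| = #|layer layN 0| ->
  equilibrium_branch f b -> lifted_from N b.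
Proof.
move=> fs c0 card0 [breg b0 bf].
have [r [rbal NE]] := liftNL; exists r; split=> //.
have [p [hp rp]] := quotient_hom rbal NE.
have [top htop] := backward_connected_generates Lback.
have inj := (first_layer_inj hN hL htop mn hp).1 card0.
have [rad rad0 finj] := local_injectivity fs c0.
have small := branch_small breg b0 rad0.
have tsmall : \forall t \near (0 : R), `|t| <= rad by exact: nbhs0_le.
near=> t => dt c d /rp; apply: (eq_fibers_from_first_layer hL hp.1 inj).
have bt : forall c, `|b t c| <= rad by move: dt; near: t; exact: small.
have tr : `|t| <= rad by near: t.
(* With equal source states, both cells satisfy the same equation in their own state, which has at
   most one small solution. *)
move=> {}c {}d _ srcE; apply: (finj _ _ (fun i => b t (src i d)) t) => //.
transitivity (0 : R); last exact/esym/(bf t dt d).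
rewrite -[RHS](bf t dt c) /vector_field; congr (f (input _ _ _)).
by apply/funext => i; rewrite srcE.
Unshelve. all: by end_near. Qed.

End Lifted.

(** * Solving the layers above the first *)

Section RightGerms.
Variable R : realType.

Lemma near_right_itv (P : R -> Prop) : (\forall t \near 0^'+, P t) ->
  \forall l \near 0^'+, forall t, 0 < t -> t < l -> P t.
Proof.
move=> /nbhs_ballP[e /= e0 eP]; near=> l; have le : l < e.
  by near: l; exact: nbhs_right_lt.
move=> t t0 tl; apply: eP => //.
by rewrite /ball /= sub0r normrN gtr0_norm// (lt_trans tl).
Unshelve. all: by end_near. Qed.

(** Derivatives are controlled only to the right of 0, as for a branch on a domain [[0, l[]. *)
Definition curve_germ (x : R -> R) : Prop :=
  [/\ x 0 = 0, x t @[t --> 0^'+] --> 0 &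
      \forall l \near 0^'+, smooth_on `]0, l[ x].

Lemma smooth_on_cst (A : set R) (a : R) : open A -> smooth_on A (cst a).
Proof. by move=> oA; apply/smooth_onP => n; exact: nderivable_cst. Qed.

Lemma smooth_on_id (A : set R) : open A -> smooth_on A id.
Proof. by move=> oA; apply/smooth_onP => n; exact: nderivable_id. Qed.

Lemma curve_germ0 : curve_germ (fun=> 0).
Proof.
split; [by []|exact: cvg_cst|].
by apply: nearW => l; apply: smooth_on_cst; exact: interval_open.
Qed.

Variables (k : nat) (f : 'rV[R]_k.+2 -> R).
Hypotheses (fs : smooth f) (f0 : f 0 = 0).
Let c := partial ord0 f 0.
Hypothesis c0 : c != 0.

(** [S] merely chooses a solution of the cell equation; the bounds on the derivative and on [S] are
    what yields its regularity along curves. *)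
Definition solves (r rho : R) (S : ('I_k -> R) -> R -> R) : Prop :=
  [/\ 0 < r, 0 < rho, rho <= r,
  (forall x y l, `|x| <= r -> (forall i, `|y i| <= r) -> `|l| <= r ->
    `|partial ord0 f (input x y l) - c| <= `|c| / 2) &
  forall y l, (forall i, `|y i| <= rho) -> `|l| <= rho ->
    [/\ `|S y l| <= r, f (input (S y l) y l) = 0 &
        `|c| / 2 * `|S y l| <= `|f (input 0 y l)|] ].

Lemma solver_exists : exists r rho S, solves r rho S.
Proof.
have [r r0 fr] := local_bound fs c0.
have c2 : 0 < `|c| / 2 by rewrite divr_gt0 ?normr_gt0.
(* On this box [f] is small enough for [root_exists] to find a root within [r]. *)
have [rho' rho'0 frho] : exists2 rho : R, 0 < rho & forall x y l,
    `|x| <= rho -> (forall i, `|y i| <= rho) -> `|l| <= rho ->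
    `|f (input x y l)| <= `|c| / 2 * r.
  apply: (@input_near0 _ _ (fun z => `|f z| <= `|c| / 2 * r)).
  have /cvgrPdist_le/(_ _ (mulr_gt0 c2 r0)) := smooth_continuous fs (x := 0).
  by apply: filterS => z; rewrite f0 sub0r normrN.
pose rho := Num.min rho' r.
have rho0 : 0 < rho by rewrite lt_min rho'0.
have rr : rho <= r by rewrite ge_min lexx orbT.
have rr' : rho <= rho' by rewrite ge_min lexx.
have /boolp.choice[S SP] : forall yl : ('I_k -> R) * R, exists s : R,
    (forall i, `|yl.1 i| <= rho) -> `|yl.2| <= rho ->
    [/\ `|s| <= r, f (input s yl.1 yl.2) = 0 &
        `|c| / 2 * `|s| <= `|f (input 0 yl.1 yl.2)|].
  move=> [y l] /=.
  have [[yr lr]|/not_andP no] :=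
      pselect ((forall i, `|y i| <= rho) /\ `|l| <= rho); last first.
    (* Default value outside the box. *)
    by exists 0 => yr lr; case: no.
  have dF s := is_derive_input y l s fs.
  have dFc s : `|s - 0| <= r ->
      `|partial ord0 f (input s y l) - c| <= `|c| / 2.
    rewrite subr0 => sr; apply: fr => //; last exact: le_trans rr.
    by move=> i; exact: le_trans (yr i) rr.
  have Fp : `|f (input 0 y l)| <= `|c| / 2 * r.
    apply: frho; rewrite ?normr0 ?(ltW rho'0)//; last exact: le_trans rr'.
    by move=> i; exact: le_trans (yr i) rr'.
  have [s sr Fs] := root_exists dF dFc r0 Fp.
  exists s => _ _; split=> //; first by rewrite -[s]subr0.
  have r00 : `|0 - 0 : R| <= r by rewrite subr0 normr0 ltW.
  by have := inverse_lipschitz dF dFc sr r00; rewrite Fs subr0 sub0r normrN.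
exists r, rho, (fun y l => S (y, l)); split=> // y l yr lr.
exact: (SP (y, l)).
Qed.

Lemma input_curve_coord (A : set R) (y : 'I_k -> R -> R) : open A ->
  (forall i, smooth_on A (y i)) ->
  forall j, smooth_on A (fun t => input 0 (y ^~ t) t 0 j).
Proof.
move=> oA yA; apply: ord_coordP => [||i].
- rewrite (_ : (fun _ => _) = cst 0); first exact: smooth_on_cst.
  by apply/funext => t; rewrite inputE.
- rewrite (_ : (fun _ => _) = id); first exact: smooth_on_id.
  by apply/funext => t; rewrite inputE.
- rewrite (_ : (fun _ => _) = y i); first exact: yA.
  by apply/funext => t; rewrite inputE.
Qed.

Lemma smooth_curve_continuous (A : set R) n (w : R -> 'rV[R]_n) t :
  (forall j, smooth_on A (fun s => w s 0 j)) -> A t ->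
  {for t, continuous w}.
Proof.
move=> wA At; apply/differentiable_continuous/derivable1_diffP.
by apply/derivable_mxP => i j; rewrite ord1; exact: (wA j 0%N).
Qed.

(** The value and the limit at 0 come from the last estimate in [solves]; smoothness to the right of
    0 comes from [implicit_smooth], the source states and the parameter forming the known curve
    [w]. *)
Lemma solver_curve (r rho : R) S (y : 'I_k -> R -> R) : solves r rho S ->
  (forall i, curve_germ (y i)) ->
  curve_germ (fun t => S (y ^~ t) t) /\
  \forall t \near 0^'+, f (input (S (y ^~ t) t) (y ^~ t) t) = 0.
Proof.
move=> [r0 rho0 rr fr SP] yg; pose x t := S (y ^~ t) t.
have c2 : 0 < `|c| / 2 by rewrite divr_gt0 ?normr_gt0.
have ysmall (e : R) : 0 < e ->
    \forall t \near 0^'+, (forall i, `|y i t| <= e) /\ `|t| <= e.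
  move=> e0; near=> t; split; last first.
    by rewrite gtr0_norm//; near: t; exact: nbhs_right_le.
  near: t; apply: filter_forall => i; have [_ yi _] := yg i.
  by move/cvgrPdist_le/(_ _ e0): yi; apply: filterS => t; rewrite sub0r normrN.
split; last first.
  have := ysmall _ rho0; apply: filterS => t [yr tr].
  by have [] := SP (y ^~ t) t yr tr.
split.
- have y0 i : y i 0 = 0 by have [] := yg i.
  have [||_ _] := SP (y ^~ 0) 0.
  + by move=> i; rewrite y0 normr0 ltW.
  + by rewrite normr0 ltW.
  rewrite (_ : y ^~ 0 = fun=> 0); last exact/funext.
  by rewrite input0 f0 normr0 pmulr_rle0// normr_le0 => /eqP.
- apply/cvgrPdist_le => e e0.
  have [e' e'0 fe'] : exists2 e' : R, 0 < e' & forall x y l,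
      `|x| <= e' -> (forall i, `|y i| <= e') -> `|l| <= e' ->
      `|f (input x y l)| <= `|c| / 2 * e.
    apply: (@input_near0 _ _ (fun z => `|f z| <= `|c| / 2 * e)).
    have /cvgrPdist_le/(_ _ (mulr_gt0 c2 e0)) := smooth_continuous fs (x := 0).
    by apply: filterS => z; rewrite f0 sub0r normrN.
  near=> t; rewrite sub0r normrN -(ler_pM2l c2).
  have [yt tt] : (forall i, `|y i t| <= e') /\ `|t| <= e'.
    by near: t; exact: ysmall.
  have [yr tr] : (forall i, `|y i t| <= rho) /\ `|t| <= rho.
    by near: t; exact: ysmall.
  have [_ _] := SP (y ^~ t) t yr tr; move=> /le_trans; apply.
  by apply: fe' => //; rewrite normr0 ltW.
- have ynear : \forall l \near 0^'+, forall i, smooth_on `]0, l[%classic (y i).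
    by apply: filter_forall => i; have [] := yg i.
  near=> l; pose A : set R := `]0, l[%classic.
  have oA : open A by exact: interval_open.
  have small : forall t, A t -> (forall i, `|y i t| <= rho) /\ `|t| <= rho.
    move=> t; rewrite /A /= in_itv /= => /andP[t0 tl]; move: t t0 tl.
    by near: l; apply: near_right_itv; exact: ysmall.
  have yA i : smooth_on A (y i).
    by apply: (near ynear l).
  pose w t := input 0 (y ^~ t) t.
  have wA := input_curve_coord oA yA.
  have xP t : A t -> [/\ `|x t| <= r, f (input (x t) (y ^~ t) t) = 0,
      (forall i, `|y i t| <= r) & `|t| <= r].
    move=> /small[yr tr]; have [xr fx _] := SP (y ^~ t) t yr tr.
    split=> //; last exact: le_trans rr.
    by move=> i; exact: le_trans (yr i) rr.
  apply: (implicit_smooth (v := delta_mx 0 ord0) (w := w) fs oA wA) => t At.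
  have [xr fx yr tr] := xP t At.
  split.
  + apply: (@implicit_continuous _ _ f (delta_mx 0 ord0) w x fs t (`|c| / 2)) => //.
    * exact: smooth_curve_continuous At.
    * by rewrite -input_line.
    have := open_nbhs_nbhs (conj oA At); apply: filterS => s As.
    have [xsr fxs ysr sr] := xP s As.
    have dFc u : `|u - 0| <= r ->
        `|partial ord0 f (input u (y ^~ s) s) - c| <= `|c| / 2.
      by rewrite subr0 => ur; exact: fr.
    rewrite -input_line; rewrite -[x t]subr0 in xr; rewrite -[x s]subr0 in xsr.
    have := inverse_lipschitz (fun u => is_derive_input (y ^~ s) s u fs) dFc xr xsr.
    by rewrite fxs subr0.
  + by rewrite -input_line.
  + rewrite dird_ord0 -input_line; apply/eqP => D0.
    have := fr _ _ _ xr yr tr; rewrite D0 sub0r normrN; apply/negP.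
    by rewrite -ltNge ltr_pdivrMr// ltr_pMr ?normr_gt0// ltr1n.
Unshelve. all: by end_near. Qed.

End RightGerms.

(** * The transcritical branch in the first layer *)

Section Beta.
Variables (R : realType) (k : nat) (f : 'rV[R]_k.+2 -> R).
Hypotheses (fs : smooth f) (ftriv : forall l, f (input 0 (fun=> 0) l) = 0).

(** With [g(x, l) = f(x, ..., x, l)], [h] on the diagonal is [g_x], and [a], [b] are [g_xx], [g_xl]
    at the origin; the model of [g] is [a / 2 * x ^+ 2 + b * l * x]. *)
Let h := dird (diag_dir R k) f.
Let a := \sum_(i | i != ord_max) partial i h 0.
Let b := partial ord_max h 0.
Hypotheses (h0 : h 0 = 0) (a0 : a != 0) (b0 : b != 0).

Local Notation diag s l := (input s (fun=> s) l).

Lemma diagonal_expansion (e : R) : 0 < e ->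
  exists2 r : R, 0 < r & forall s l, `|s| <= r -> `|l| <= r ->
    `|h (diag s l) - (a * s + b * l)| <= e * (`|s| + `|l|).
Proof.
move=> e0.
have hd : differentiable h 0 by exact/smooth_differentiable/smooth_dird.
have [r r0 hr] : exists2 r : R, 0 < r & forall x y l,
    `|x| <= r -> (forall i, `|y i| <= r) -> `|l| <= r ->
    `|h (input x y l) - 'd h 0 (input x y l)| <= e * `|input x y l|.
  apply: (@input_near0 _ _ (fun z => `|h z - 'd h 0 z| <= e * `|z|)).
  have /diff_locally/eqaddoP/(_ _ e0) := hd; apply: filterS => z.
  by rewrite !fctE /= addr0 h0 add0r.
exists r => // s l sr lr; have := hr s (fun=> s) l sr (fun=> sr) lr.
have -> : 'd h 0 (diag s l) = a * s + b * l.
  rewrite -deriveE//; have := is_derive_partial (diag s l) hd.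
  move=> dh; rewrite derive_val (bigD1 ord_max)//= input_max addrC (mulrC l).
  congr (_ + _); rewrite mulr_suml; apply: eq_bigr => j.
  by move: j; apply: ord_coordP => [||i]; rewrite ?eqxx// inputE mulrC.
move=> /le_trans; apply; rewrite ler_wpM2l ?(ltW e0)//.
rewrite [leLHS]/Num.Def.normr /= mx_normrE.
apply: bigmax_le => [|[i j] _ /=]; first by rewrite addr_ge0.
rewrite ord1; move: j; apply: ord_coordP => [||i']; rewrite inputE;
  by rewrite ?lerDl ?lerDr.
Qed.

(** [y0 * l] is the nonzero root of the quadratic model. Within [delta * l] of it the model slope
    differs from [- b * l] by at most [|b| * l / 4], and [|y0| = 8 * delta] keeps this sector away
    from 0. *)
Let delta := `|b| / (4 * `|a|).
Let y0 := - (2 * b / a).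

Let a_gt0 : 0 < `|a|. Proof. by rewrite normr_gt0. Qed.
Let b_gt0 : 0 < `|b|. Proof. by rewrite normr_gt0. Qed.
Let delta0 : 0 < delta. Proof. by rewrite divr_gt0// mulr_gt0. Qed.
Let deltaE : `|a| * delta = `|b| / 4.
Proof. by rewrite /delta; field; rewrite gt_eqF. Qed.
Let y0E : `|y0| = 8 * delta.
Proof.
rewrite /y0 normrN !normrM normfV normr_nat /delta; field.
by rewrite gt_eqF.
Qed.

Let is_derive_diag (l s : R) :
  is_derive s 1 (fun s : R => f (diag s l)) (h (diag s l)).
Proof.
have := is_derive_line (input 0 (fun=> 0) l) (diag_dir R k) s fs.
rewrite -input_diagonal; congr is_derive.
by apply/funext => u; rewrite [in RHS]input_diagonal.
Qed.

(* On the scale [x = y * l] the diagonal equation has the simple root [y0],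
   which is isolated with radius [delta]. *)
Lemma scaled_root_bounds : exists2 rho : R, 0 < rho & forall l,
  0 < l -> l <= rho ->
  (forall s, `|s - y0 * l| <= delta * l ->
     `|h (diag s l) - - b * l| <= `|- b * l| / 2) /\
  `|f (diag (y0 * l) l)| <= `|- b * l| / 2 * (delta / 2 * l).
Proof.
(* In the sector [|s|] is at most [(8 + 1) * delta * l], so [|s| + |l|] is at most [M * l]; [e] then
   makes the error of the expansion at most [|b| / 32 * l]. *)
have d0 := delta0; pose M := 9 * delta + 1; have M0 : 0 < M by rewrite /M; lra.
pose e := `|b| / (32 * M).
have e0 : 0 < e by rewrite divr_gt0// mulr_gt0.
have eM : e * M = `|b| / 32 by rewrite /e; field; rewrite gt_eqF.
have [r r_gt0 hr] := diagonal_expansion e0.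
exists (r / M); first by rewrite divr_gt0.
move=> l l0; rewrite ler_pdivlMr// => lMr.
have normbl : `|- b * l| = `|b| * l by rewrite normrM normrN (gtr0_norm l0).
have normy0l : `|y0 * l| = 8 * delta * l by rewrite normrM y0E (gtr0_norm l0).
have lr : `|l| <= r.
  by rewrite (gtr0_norm l0) (le_trans _ lMr)// ler_peMr ?ltW// /M; lra.
have hM s : `|s| <= 9 * delta * l ->
    `|h (diag s l) - (a * s + b * l)| <= `|b| / 32 * l.
  move=> sl; rewrite -eM -mulrA.
  have sM : `|s| + `|l| <= M * l by rewrite (gtr0_norm l0) /M; lra.
  apply: (le_trans (hr s l _ lr)); last by rewrite ler_pM2l.
  by move: sM; have := normr_ge0 l; rewrite mulrC; lra.
have dl0 : 0 < delta * l by rewrite mulr_gt0.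
rewrite normbl; split.
  move=> s sd; have sl : `|s| <= 9 * delta * l.
    by have := ler_normD (s - y0 * l) (y0 * l); rewrite subrK normy0l; lra.
  have asd : `|a * s + 2 * (b * l)| <= `|b| / 4 * l.
    have -> : a * s + 2 * (b * l) = a * (s - y0 * l).
      by rewrite /y0; field.
    by rewrite normrM -deltaE -mulrA ler_pM2l.
  have -> : h (diag s l) - - b * l =
      (h (diag s l) - (a * s + b * l)) + (a * s + 2 * (b * l)) by ring.
  apply: (le_trans (ler_normD _ _)); have := hM s sl.
  have bl0 : 0 < `|b| * l by rewrite mulr_gt0.
  by move: asd; lra.
(* The model vanishes at 0 and at [y0 * l], so the mean value theorem for the remainder [G] bounds
   [f] there by [|b| / 32 * l] times [8 * delta * l], exactly the required bound. *)
pose G s := f (diag s l) - (a / 2 * s ^+ 2 + b * l * s).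
have dG (s : R) : is_derive s 1 G (h (diag s l) - (a * s + b * l)).
  have d2 : is_derive s 1 (fun s : R => a / 2 * s ^+ 2 + b * l * s)
      (a * s + b * l).
    pose g : R -> R := cst (a / 2) * (id * id) + cst (b * l) * id.
    rewrite (_ : (fun s => _) = g); last by apply/funext => u; rewrite /g !fctE expr2.
    have di := is_derive_id s (1 : R).
    have := is_deriveD (is_deriveM (is_derive_cst (a / 2) s 1) (is_deriveM di di))
      (is_deriveM (is_derive_cst (b * l) s 1) di).
    move=> dg; apply: is_derive_eq dg _.
    by rewrite /GRing.scale /=; field.
  exact: (is_deriveB (is_derive_diag l s) d2).
have [xi xiP] := mean_value 0 (y0 * l) dG.
have -> : G (y0 * l) = f (diag (y0 * l) l).
  rewrite /G (_ : a / 2 * _ + _ = 0) ?subr0// /y0; field.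
  exact: a0.
have -> : G 0 = 0 by rewrite /G ftriv; ring.
rewrite !subr0 => ->; rewrite normrM normy0l.
have xil : `|xi| <= 9 * delta * l.
  have : `|xi| <= `|y0 * l|.
    case/orP: xiP => /andP[? ?]; first by rewrite !ger0_norm//; lra.
    by rewrite !ler0_norm//; lra.
  by rewrite normy0l; lra.
have := hM xi xil.
rewrite -(ler_pM2r (x := 8 * delta * l)); last by lra.
by move=> /le_trans; apply; lra.
Qed.

Lemma diagonal_branch : exists beta : R -> R, [/\ curve_germ beta,
  \forall t \near 0^'+, f (diag (beta t) t) = 0 &
  exists2 e : R, 0 < e & \forall t \near 0^'+, e * t <= `|beta t|].
Proof.
have d0 := delta0; have [rho rho0 rhoP] := scaled_root_bounds.
(* The root is taken within half the radius of the sector, so that [beta t] still lies in the full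
   sector at nearby parameters; this is used for continuity. *)
have /boolp.choice[beta betaP] : forall t : R, exists s : R, (t = 0 -> s = 0) /\
    (0 < t -> t <= rho -> `|s - y0 * t| <= delta / 2 * t /\ f (diag s t) = 0).
  move=> t; have [[t0 tr]|no] := pselect (0 < t /\ t <= rho); last first.
    by exists 0; split=> // t0 tr; case: no.
  have [dFc Fp] := rhoP t t0 tr.
  have dFc' s : `|s - y0 * t| <= delta / 2 * t ->
      `|h (diag s t) - - b * t| <= `|- b * t| / 2.
    move=> sd; apply: dFc; apply: (le_trans sd).
    by rewrite ler_pM2r//; lra.
  have r0 : 0 < delta / 2 * t by rewrite mulr_gt0// divr_gt0.
  have [s sd fs0] := root_exists (is_derive_diag t) dFc' r0 Fp.
  by exists s; split=> // t00; rewrite t00 ltxx in t0.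
have near_rho : \forall t \near 0^'+, 0 < t /\ t <= rho.
  near=> t; split; first by [].
  by near: t; exact: nbhs_right_le.
exists beta; split; last first.
(* [|beta t|] is at least [8 * delta * t - delta / 2 * t]. *)
- exists delta => //; apply: filterS near_rho => t [t0 tr].
  have [_ /(_ t0 tr)[bd _]] := betaP t.
  have := lerB_dist (y0 * t) (beta t).
  have dt0 : 0 < delta * t by rewrite mulr_gt0.
  by rewrite normrM y0E (gtr0_norm t0) (distrC (y0 * t)); move: bd; lra.
- apply: filterS near_rho => t [t0 tr].
  by have [_ /(_ t0 tr)[]] := betaP t.
split.
- by have [-> //] := betaP 0.
- apply/cvgrPdist_le => e e0.
  near=> t; rewrite sub0r normrN.
  have [t0 tr] : 0 < t /\ t <= rho by near: t.
  have te : t <= e / (9 * delta).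
    by near: t; apply: nbhs_right_le; rewrite divr_gt0// mulr_gt0.
  have [_ /(_ t0 tr)[bd _]] := betaP t.
  have bt : `|beta t| <= `|beta t - y0 * t| + `|y0 * t|.
    by rewrite -[in leLHS](subrK (y0 * t) (beta t)) ler_normD.
  have dt0 : 0 < delta * t by rewrite mulr_gt0.
  have normy0t : `|y0 * t| = 8 * delta * t by rewrite normrM y0E (gtr0_norm t0).
  have te' : t * (9 * delta) <= e by rewrite -ler_pdivlMr// mulr_gt0.
  by move: bd bt; rewrite normy0t; lra.
- near=> l; pose A : set R := `]0, l[%classic.
  have oA : open A by exact: interval_open.
  have lrho : l <= rho by near: l; exact: nbhs_right_le.
  have AP t : A t -> 0 < t /\ t <= rho.
    rewrite /A /= in_itv /= => /andP[t0 tl]; split=> //.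
    by rewrite ltW// (lt_le_trans tl).
  pose w (t : R) : 'rV[R]_k.+2 := input 0 (fun=> 0) t.
  have wA : forall j, smooth_on A (fun t => w t 0 j).
    by apply: input_curve_coord => // i; exact: smooth_on_cst.
  apply: (implicit_smooth (v := diag_dir R k) (w := w) fs oA wA) => t At.
  have [t0 tr] := AP t At; have [_ /(_ t0 tr)[bd fb]] := betaP t.
  have [dFc _] := rhoP t t0 tr.
  have dt0 : 0 < delta * t by rewrite mulr_gt0.
  rewrite -input_diagonal; split => //; last first.
    have /dFc h1 : `|beta t - y0 * t| <= delta * t by move: bd; lra.
    apply/eqP; rewrite -/h => hb; move: h1; rewrite hb sub0r normrN.
    apply/negP; rewrite -ltNge ltr_pdivrMr// ltr_pMr ?ltr1n// normr_gt0.
    by rewrite mulf_neq0 ?oppr_eq0// gt_eqF.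
  (* The Lipschitz constant at [s] is [|b| * s / 2], and [s] will be at least [t / 2]. *)
  have kappa0 : 0 < `|b| * t / 4 by rewrite divr_gt0// mulr_gt0.
  apply: (@implicit_continuous _ _ f (diag_dir R k) w beta fs t _ kappa0).
  + exact: smooth_curve_continuous At.
  + by rewrite -input_diagonal.
  (* Then [|beta t - y0 * s|] is at most [(1 / 2 + 8 / 18) * delta * t], which is
     [17 / 18 * delta * t] and so at most [delta * s]. *)
  have near_t : \forall s \near t, `|t - s| <= t / 18.
    have t18 : 0 < t / 18 by rewrite divr_gt0.
    by have /cvgrPdist_le/(_ _ t18) := @cvg_id _ (nbhs t).
  have := open_nbhs_nbhs (conj oA At); move: near_t; apply: filterS2 => s ts As.
  have [s0 sr] := AP s As; have [_ /(_ s0 sr)[bds fbs]] := betaP s.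
  have [dFs _] := rhoP s s0 sr.
  have ts' : t - s <= t / 18 by exact: le_trans (ler_norm _) ts.
  have bds' : `|beta s - y0 * s| <= delta * s.
    by apply: (le_trans bds); rewrite ler_pM2r//; lra.
  have dts : delta * `|t - s| <= delta * (t / 18) by rewrite ler_pM2l.
  have dts' : delta * (t - s) <= delta * (t / 18) by rewrite ler_pM2l.
  have bts : `|beta t - y0 * s| <= delta * s.
    have := ler_normD (beta t - y0 * t) (y0 * (t - s)).
    rewrite (_ : _ + y0 * (t - s) = beta t - y0 * s); last by ring.
    by rewrite normrM y0E; move: bd; lra.
  rewrite -input_diagonal.
  have := inverse_lipschitz (is_derive_diag s) dFs bts bds'.
  rewrite fbs subr0; apply: le_trans; rewrite ler_wpM2r//.
  rewrite normrM normrN (gtr0_norm s0).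
  have := b_gt0; have : `|b| * (t / 2) <= `|b| * s by rewrite ler_pM2l//; lra.
  by lra.
Unshelve. all: by end_near. Qed.

End Beta.

(** * Branches that are not lifted *)

Section Unlifted.
Variables (R : realType) (k : nat) (f : 'rV[R]_k.+2 -> R).
Hypotheses (fs : smooth f) (ftriv : forall l, f (input 0 (fun=> 0) l) = 0).
Let h := dird (diag_dir R k) f.
Hypotheses (c0 : partial ord0 f 0 != 0) (h0 : h 0 = 0).
Hypothesis a0 : \sum_(i | i != ord_max) partial i h 0 != 0.
Hypothesis b0 : partial ord_max h 0 != 0.
Variables (L : network k) (n : nat) (layL : L -> nat).
Hypothesis hL : feed_forward n layL.

Let f0 : f 0 = 0. Proof. by rewrite -input0 ftriv. Qed.

Lemma curves_extend (init : L -> R -> R) :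
  (forall c, curve_germ (init c)) ->
  (forall c, \forall t \near 0^'+, f (input (init c t) (fun=> init c t) t) = 0) ->
  exists X : L -> R -> R,
  [/\ forall c, layL c = 0%N -> X c = init c, forall c, curve_germ (X c) &
    forall c, \forall t \near 0^'+,
      vector_field f (X ^~ t) t c = 0].
Proof.
move=> initg initf; have [r [rho [S SP]]] := solver_exists fs f0 c0.
(* The layer number serves as recursion depth: [Y j c] is the intended state when [j = layL c]. *)
pose Y := fix Y j (c : L) (t : R) := if j is j'.+1 then
  S (fun i => Y j' (src i c) t) t else init c t.
have Yg j c : curve_germ (Y j c).
  elim: j c => [|j IH] c; first exact: initg.
  by have [] := solver_curve fs f0 c0 SP (fun i => IH (src i c)).
exists (fun c => Y (layL c) c); split=> [c ->|c|c] //.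
case layE : (layL c) => [|j].
  have := initf c; apply: filterS => t; rewrite /vector_field layE /=.
  suff -> : (fun i => Y (layL (src i c)) (src i c) t) = fun=> init c t by [].
  by apply/funext => i; rewrite (ff_first hL)// layE.
have [_] := solver_curve fs f0 c0 SP (fun i => Yg j (src i c)).
apply: filterS => t; rewrite /vector_field layE.
suff -> : (fun i => Y (layL (src i c)) (src i c) t) =
  (fun i => Y j (src i c) t) by [].
by apply/funext => i; rewrite (ff_next hL i layE).
Qed.

Lemma gap_branch_exists (c d : L) :
  layL c = 0%N -> layL d = 0%N -> c != d ->
  exists b : branch R L, equilibrium_branch f b /\ gap b c d.
Proof.
move=> layc layd cd; have [beta [betag betaf [e e0 ebeta]]] :=
  diagonal_branch fs ftriv h0 a0 b0.
pose init (c' : L) : R -> R := if c' == c then beta else fun=> 0.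
have [||X [Xinit Xg Xf]] := @curves_extend init.
- by move=> c'; rewrite /init; case: ifP => _; [exact: betag|exact: curve_germ0].
- move=> c'; rewrite /init; case: ifP => _; first exact: betaf.
  by apply: nearW => t; exact: ftriv.
have [l [l0 Xl Xs]] : exists l : R, [/\ 0 < l,
    forall t, 0 < t -> t < l -> forall c, vector_field f (X ^~ t) t c = 0 &
    forall c, smooth_on `]0, l[%classic (X c)].
  have Xf' : \forall t \near 0^'+, forall c, vector_field f (X ^~ t) t c = 0.
    by apply: filter_forall => c'; exact: Xf.
  have Xs' : \forall l \near 0^'+, forall c, smooth_on `]0, l[%classic (X c).
    by apply: filter_forall => c'; have [] := Xg c'.
  near (0 : R)^'+ => l; exists l; split; last exact: (near Xs' l).
    by [].
  exact: (near (near_right_itv Xf') l).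
have X0 c' : X c' 0 = 0 by have [] := Xg c'.
exists (Branch `[0, l[%classic (fun t c' => X c' t)); split; first split => //=.
- exists l => //; right; split; first by right.
  move=> c' /=; split; last first.
    move=> j t [/=]; rewrite in_itv /= => /andP[t0 tl] /eqP tn0.
    by apply: Xs; rewrite /= in_itv /= tl andbT lt_neqAle t0 eq_sym tn0.
  apply/subspace_continuousP => t /=; rewrite in_itv /= => /andP[t0 tl].
  move: t0; rewrite le_eqVlt => /predU1P[<-|t0]; last first.
    apply: cvg_within_filter; apply: differentiable_continuous.
    by apply/derivable1_diffP; apply: (Xs c' 0%N); rewrite /= in_itv /= t0.
  suff lim : X c' @ within `[0, l[%classic (nbhs (0 : R)) --> (0 : R).
    by move: lim; rewrite -[y in _ --> y](X0 c').
  have [_ Xc0 _] := Xg c'; apply/cvgrPdist_le => e' e'0.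
  have /cvgrPdist_le/(_ _ e'0) := Xc0; rewrite !near_withinE.
  apply: filterS => s + s0; rewrite /= in_itv /= in s0.
  case/andP: s0; rewrite le_eqVlt => /predU1P[<- _ _|s0 _]; last exact.
  by rewrite X0 subr0 normr0 ltW.
- move=> t; rewrite in_itv /= => /andP[t0 tl] c'.
  move: t0; rewrite le_eqVlt => /predU1P[<-|t0]; last exact: Xl.
  rewrite /vector_field X0 (_ : (fun i => _) = fun=> 0) ?ftriv//.
  by apply/funext => i; exact: X0.
exists e => //=; move: ebeta; rewrite near_withinE; apply: filterS => t.
rewrite in_itv /= => et /andP[+ _].
rewrite le_eqVlt => /predU1P[<-|t0]; first by rewrite normr0 mulr0.
by rewrite !Xinit// /init eqxx eq_sym (negbTE cd) subr0 gtr0_norm// et.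
Unshelve. all: by end_near. Qed.

End Unlifted.

(** * Statement (ii): first-layer cells identified by every coloring *)

Section PartTwo.
Variables (R : realType) (k : nat) (N L : network k) (m n : nat).
Variables (layN : N -> nat) (layL : L -> nat).
Hypotheses (hN : feed_forward m layN) (hL : feed_forward n layL).
Hypotheses (liftNL : is_lift N L) (Lback : backward_connected L).
Hypothesis mn : (m <= n)%N.

(** One homomorphism identifies two first-layer cells, and every admissible coloring has the fibers
    of that same homomorphism, by [surj_hom_unique]. *)
Lemma synchrony_unique : #|layer layL 0| <> #|layer layN 0| ->
  exists c d, [/\ layL c = 0%N, layL d = 0%N, c != d &
    forall r : equiv_rel L, balanced r -> network_eq N (quotient_network r) ->
      r c d].
Proof.
move=> card0; have [r [rbal NE]] := liftNL.
have [p [hp _]] := quotient_hom rbal NE.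
have [top htop] := backward_connected_generates Lback.
have : ~ {in layer layL 0 &, injective p}.
  by move/(first_layer_inj hN hL htop mn hp).
move=> /existsNP[c] /existsNP[d] /not_implyP[cL /not_implyP[dL]].
move=> /not_implyP[pcd /eqP cd]; move: cL dL; rewrite !inE => /eqP cL /eqP dL.
exists c, d; split=> // r' r'bal NE'.
have [q [hq rq]] := quotient_hom r'bal NE'; apply/rq.
by have pq := surj_hom_unique hN htop hp hq; rewrite -!pq.
Qed.

(** The gap passes to all equivalent branches, whereas the trivial branch and any lifted branch have
    equal states at [c] and [d]. *)
Lemma unlifted_branch (f : 'rV[R]_k.+2 -> R) (c d : L) (b : branch R L) :
  (forall r : equiv_rel L, balanced r -> network_eq N (quotient_network r) ->
      r c d) ->
  equilibrium_branch f b -> gap b c d ->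
  bifurcation_branch f b /\
  forall b' : branch R L, germ_eq f b b' -> ~ lifted_from N b'.
Proof.
move=> rcd bf bgap; split; first split=> //.
  move=> btriv; have breg := germ_eq_regular btriv.
  by apply: (gap_neq breg (gap_germ_eq btriv bgap)); apply: filterE => t _.
move=> b' bb' [r [rbal NE sync]].
apply: (gap_neq (germ_eq_regular bb') (gap_germ_eq bb' bgap)).
by apply: filterS sync => t + dt => /(_ dt); apply; exact: rcd.
Qed.

End PartTwo.

(** * Nondegenerate jets *)

Section Genericity.
Variables (R : realType) (k : nat).
Local Notation jet := ('rV[R]_k.+2 * 'M[R]_k.+2)%type.
Implicit Types (f g : 'rV[R]_k.+2 -> R) (J : jet).

(* With [g(x, l) = f(x, ..., x, l)], the last two quantities are the second
derivatives [g_xx] and [g_xl] at the origin. *)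
Definition jet_x0 J : R := J.1 0 ord0.
Definition jet_xx J : R :=
  \sum_(i | i != ord_max) \sum_(j | j != ord_max) J.2 i j.
Definition jet_xl J : R := \sum_(j | j != ord_max) J.2 ord_max j.

Definition nondegenerate_jet : set jet :=
  [set J | [/\ jet_x0 J != 0, jet_xx J != 0 & jet_xl J != 0]].

Lemma jet2_x0 f : jet_x0 (jet2 f) = partial ord0 f 0.
Proof. by rewrite /jet_x0 mxE. Qed.

Lemma partial_sum n i (I : Type) (r : seq I) (P : pred I)
    (F : I -> 'rV[R]_n -> R) : (forall j, P j -> smooth (F j)) ->
  partial i (\sum_(j <- r | P j) F j) = \sum_(j <- r | P j) partial i (F j).
Proof.
move=> Fs; elim: r => [|j r IH]; first by rewrite !big_nil; exact: partial_cst.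
rewrite !big_cons; case: ifP => // Pj; rewrite partialD ?IH//; first exact: Fs.
exact: smooth_sum.
Qed.

Lemma partial_dird_diag f i : smooth f ->
  partial i (dird (diag_dir R k) f) 0 =
  \sum_(j | j != ord_max) partial i (partial j f) 0.
Proof.
move=> fs; have -> : dird (diag_dir R k) f = \sum_(j | j != ord_max) partial j f.
  by apply/funext => z; rewrite dird_diag fct_sumE.
by rewrite partial_sum ?fct_sumE// => j _; exact: smooth_partial.
Qed.

Lemma jet2_xx f : smooth f -> jet_xx (jet2 f) =
  \sum_(i | i != ord_max) partial i (dird (diag_dir R k) f) 0.
Proof.
move=> fs; apply: eq_bigr => i _; rewrite partial_dird_diag//.
by apply: eq_bigr => j _; rewrite mxE.
Qed.

Lemma jet2_xl f : smooth f ->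
  jet_xl (jet2 f) = partial ord_max (dird (diag_dir R k) f) 0.
Proof.
move=> fs; rewrite partial_dird_diag//.
by apply: eq_bigr => j _; rewrite mxE.
Qed.

Lemma continuous_jet1 i : continuous (fun J : jet => J.1 0 i).
Proof.
by move=> J; apply: (@cvg_comp _ _ _ fst (fun r : 'rV[R]_k.+2 => r 0 i) _ (nbhs J.1));
  [exact: cvg_fst|exact: coord_continuous].
Qed.

Lemma continuous_jet2 i j : continuous (fun J : jet => J.2 i j).
Proof.
by move=> J; apply: (@cvg_comp _ _ _ snd (fun M : 'M[R]_k.+2 => M i j) _ (nbhs J.2));
  [exact: cvg_snd|exact: coord_continuous].
Qed.

Lemma nondegenerate_open : open nondegenerate_jet.
Proof.
have neq_open (q : jet -> R) : continuous q -> open [set J | q J != 0].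
  by move/continuousP => qc; exact: (qc _ (@open_neq R 0)).
rewrite (_ : nondegenerate_jet = [set J | jet_x0 J != 0] `&`
  [set J | jet_xx J != 0] `&` [set J | jet_xl J != 0]); last first.
  by apply/seteqP; split=> J /=; [case|case=> -[]].
apply: openI; first apply: openI.
- by apply: (neq_open jet_x0); exact: continuous_jet1.
- apply: (neq_open jet_xx); apply: (continuous_big (@add_continuous R)) => i _.
  by apply: (continuous_big (@add_continuous R)) => j _; exact: continuous_jet2.
- apply: (neq_open jet_xl); apply: (continuous_big (@add_continuous R)) => j _.
  exact: continuous_jet2.
Qed.

Lemma jet2_line f g (e : R) : smooth f -> smooth g ->
  jet2 (f + cst e * g) = jet2 f + e *: jet2 g.
Proof.
move=> fs gs.
have pE i (f1 g1 : 'rV[R]_k.+2 -> R) : smooth f1 -> smooth g1 ->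
    partial i (f1 + cst e * g1) = partial i f1 + cst e * partial i g1.
  move=> s1 s2; rewrite partialD//; last exact: (smoothM (smooth_cst _ _) s2).
  by rewrite partialM ?partial_cst ?mulr0 ?addr0//; exact: smooth_cst.
rewrite /jet2; congr pair.
  by apply/rowP => i; rewrite !mxE pE.
apply/matrixP => i j; rewrite !mxE pE// pE//; exact: smooth_partial.
Qed.

Lemma jet_x0_line J J' (e : R) : jet_x0 (J + e *: J') = jet_x0 J + e * jet_x0 J'.
Proof. by rewrite /jet_x0 !mxE. Qed.

Lemma jet_xx_line J J' (e : R) : jet_xx (J + e *: J') = jet_xx J + e * jet_xx J'.
Proof.
rewrite /jet_xx mulr_sumr -big_split; apply: eq_bigr => i _ /=.
by rewrite mulr_sumr -big_split; apply: eq_bigr => j _; rewrite !mxE.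
Qed.

Lemma jet_xl_line J J' (e : R) : jet_xl (J + e *: J') = jet_xl J + e * jet_xl J'.
Proof.
by rewrite /jet_xl mulr_sumr -big_split; apply: eq_bigr => i _; rewrite !mxE.
Qed.

Lemma near_affine_neq0 (x y : R) : y != 0 -> \forall e \near 0^', x + e * y != 0.
Proof.
move=> y0; have [->|x0] := eqVneq x 0.
  near=> e; rewrite add0r mulf_neq0//.
  by near: e; exact: nbhs_dnbhs_neq.
(* The only zero lies at distance [|x| / |y|] from 0. *)
near=> e; rewrite addr_eq0; apply/eqP => xe.
have : `|e| < `|x| / `|y|.
  by near: e; apply: dnbhs0_lt; rewrite divr_gt0 ?normr_gt0.
by rewrite ltr_pdivlMr ?normr_gt0// -normrM xe normrN ltxx.
Unshelve. all: by end_near. Qed.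

Lemma Vk_line f g (e : R) : Vk f -> Vk g -> Vk (f + cst e * g).
Proof.
move=> [[fs f0] fk] [[gs g0] gk]; split; first split.
- exact: (smoothD fs (smoothM (smooth_cst _ _) gs)).
- by move=> l; rewrite !fctE f0 g0 mulr0 addr0.
have -> : \sum_(j < k.+2 | j != ord_max) partial j (f + cst e * g) 0 =
    \sum_(j < k.+2 | j != ord_max) (partial j f 0 + e * partial j g 0).
  apply: eq_bigr => j _; have := jet2_line e fs gs => /(congr1 fst)/rowP/(_ j).
  by rewrite !mxE.
by rewrite big_split /= fk -mulr_sumr gk mulr0 addr0.
Qed.

(** Along [f + e * g], which stays in [Vk], the three quantities are affine in [e] with nonzero
    slope, so they are nonzero for all small [e] other than 0. *)
Lemma nondegenerate_dense g : Vk g -> nondegenerate_jet (jet2 g) ->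
  @jet2 R k.+2 @` @Vk R k `<=`
  closure (nondegenerate_jet `&` @jet2 R k.+2 @` @Vk R k).
Proof.
move=> gV [g1 g2 g3] _ [f fV <-] B.
have lim : jet2 f + e *: jet2 g @[e --> (0 : R)^'] --> jet2 f.
  rewrite -[X in _ --> X]addr0 -(scale0r (jet2 g)).
  by apply: cvgD; [exact: cvg_cst|apply: cvgZr_tmp; exact: nbhs_dnbhs].
move=> /lim nB; near ((0 : R)^') => e.
have [[fs _] _] := fV; have [[gs _] _] := gV.
exists (jet2 (f + cst e * g)); split; last first.
  by rewrite jet2_line//; near: e; exact: nB.
split; last by exists (f + cst e * g) => //; exact: Vk_line.
rewrite jet2_line//; split.
- by rewrite (jet_x0_line (jet2 f)); near: e; exact: near_affine_neq0.
- by rewrite (jet_xx_line (jet2 f)); near: e; exact: near_affine_neq0.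
- by rewrite (jet_xl_line (jet2 f)); near: e; exact: near_affine_neq0.
Unshelve. all: by end_near. Qed.

End Genericity.

(** * A function with nondegenerate jet, for at least one edge type *)

Section Witness.
Variables (R : realType) (k : nat).
Let n := k.+3.
Let i1 : 'I_n := lift ord0 (lift ord_max ord0).
Let d (i j : 'I_n) : R := (i == j)%:R.
Local Notation X j := (@coordf R n j).

(** The linear part [x_0 - x_1] cancels on the diagonal, leaving [x ^ 2 + x l], while [f_0 = 1].
    With no edge types, [Vk] would force [f_0 = 0]. *)
Let p : 'rV[R]_n -> R :=
  X ord0 + cst (-1) * X i1 + X ord0 * (X ord0 + X ord_max).

Let partial_linear i (x : R) j :
  partial i (cst x * X j) = cst (x * d i j).
Proof.
rewrite partialM; [|exact: smooth_cst|exact: smooth_coordf].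
rewrite partial_cst mulr0 addr0 partial_coordf.
by apply/funext => z; rewrite !fctE.
Qed.

Let smooth_linear (x : R) j : smooth (cst x * X j).
Proof. exact: (smoothM (smooth_cst _ _) (smooth_coordf _ _)). Qed.

Let partial_p i : partial i p =
  cst (d i ord0 - d i i1) + cst (d i ord0 *+ 2 + d i ord_max) * X ord0 +
  cst (d i ord0) * X ord_max.
Proof.
have s0 := smooth_coordf R (ord0 : 'I_n).
have sm := smooth_coordf R (ord_max : 'I_n).
have s0m := smoothD s0 sm; have sl := smooth_linear (-1) i1.
rewrite partialD; [|exact: smoothD|exact: smoothM].
rewrite partialD// partial_linear partialM// partialD// !partial_coordf.
by apply/funext => z; rewrite !fctE -/(d _ _); ring.
Qed.

Let partial2_p i j : partial i (partial j p) 0 =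
  (d j ord0 *+ 2 + d j ord_max) * d i ord0 + d j ord0 * d i ord_max.
Proof.
have sl x l := smooth_linear x l.
have sc x := @smooth_cst R n x.
rewrite partial_p partialD; [|exact: (smoothD (sc _) (sl _ _))|exact: sl].
rewrite partialD; [|exact: sc|exact: sl].
by rewrite partial_cst !partial_linear !fctE add0r.
Qed.

Let i1_max : i1 != ord_max. Proof. by rewrite -val_eqE. Qed.

Let sum_d (P : pred 'I_n) i : P i -> \sum_(j | P j) d j i = 1.
Proof.
move=> Pi; rewrite (bigD1 i)//= /d eqxx big1 ?addr0// => j /andP[_ /negbTE ->].
by [].
Qed.

Let dmax j : j != ord_max -> d j ord_max = 0.
Proof. by rewrite /d => /negbTE ->. Qed.

Lemma nondegenerate_witness :
  exists g : 'rV[R]_n -> R, Vk g /\ nondegenerate_jet (jet2 g).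
Proof.
have s0 := smooth_coordf R (ord0 : 'I_n).
have sm := smooth_coordf R (ord_max : 'I_n).
have ps : smooth p.
  exact: (smoothD (smoothD s0 (smooth_linear _ _)) (smoothM s0 (smoothD s0 sm))).
have p1 i : partial i p 0 = d i ord0 - d i i1.
  by rewrite partial_p !fctE /coordf !mxE !mulr0 !addr0.
exists p; split; first split; first split=> //.
- by move=> l; rewrite /p !fctE /coordf input_ord0 input_lift; ring.
- under eq_bigr do rewrite p1.
  by rewrite sumrB !sum_d ?subrr.
split.
- by rewrite jet2_x0 p1 /d eqxx subr0 oner_eq0.
- rewrite /jet_xx; under eq_bigr => i im.
    under eq_bigr => j jm do rewrite mxE partial2_p (dmax im) (dmax jm) mulr0 !addr0.
    rewrite -mulr_suml sumrMnl sum_d//; over.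
  by rewrite -mulr_sumr sum_d// mulr1 pnatr_eq0.
- rewrite /jet_xl; under eq_bigr => j jm do rewrite mxE partial2_p (dmax jm).
  rewrite /d eqxx; under eq_bigr do rewrite mulr0 add0r mulr1 -/(d _ _).
  by rewrite sum_d// oner_eq0.
Qed.

End Witness.

(** * Networks without edge types *)

Lemma no_edge_type_depth (N : network 0) n (lay : N -> nat) :
  feed_forward n lay -> n = 0%N.
Proof.
move=> hN; apply/eqP; rewrite -leqn0 leqNgt; apply/negP => n0.
have [c c0] := ff_nonempty hN (leq0n n).
by have [[]] := ff_onto hN n0 c0.
Qed.

Lemma no_edge_type_eq (N : network 0) (c d : N) : connected_network N -> c = d.
Proof.
move=> /(_ c d)/connectP[[|e s] /=]; first by move=> _ ->.
by case/andP=> /orP[] /existsP[[]].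
Qed.

Theorem proposition6p2 (R : realType) (k : nat) (N : network k) (m : nat)
    (layN : N -> nat) (hN : feed_forward m layN) :
  generic (@Vk R k) (fun f =>
    forall (L : network k) (n : nat) (layL : L -> nat),
      feed_forward n layL -> is_lift N L -> backward_connected L ->
      ((lift_creates_layers m layN n layL \/
        (exists j : nat, j <> 0%N /\ lift_inside_layer m layN n layL j)) ->
       forall b : branch R L, bifurcation_branch f b -> lifted_from N b)
      /\
      (lift_inside_layer m layN n layL 0%N ->
       exists b : branch R L, bifurcation_branch f b /\
         forall b' : branch R L, germ_eq f b b' -> ~ lifted_from N b')).
Proof.
case: k N layN hN => [|k] N layN hN.
  exists (@jet2 R 2 @` @Vk R 0); split; last 1 first.
  - move=> f fV _ L n layL hL liftNL Lback.
    have n0 := no_edge_type_depth hL; have m0 := no_edge_type_depth hN.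
    split=> [[[]|[j [j0 []]]]|[mn _ card0 _]].
    + by rewrite n0.
    + by move=> _; rewrite m0 leqn0 => /eqP.
    + have [c [d [_ _ /eqP cd _]]] :=
        synchrony_unique hN hL liftNL Lback (eq_leq mn) card0.
      by case: cd; exact: no_edge_type_eq (ff_connected hL).
  - by exists setT; [exact: openT|rewrite setTI].
  - exact: subset_closure.
have [g [gV gnd]] := nondegenerate_witness R k.
exists (@nondegenerate_jet R k.+1 `&` @jet2 R k.+3 @` @Vk R k.+1); split.
- by exists (@nondegenerate_jet R k.+1) => //; exact: nondegenerate_open.
- exact: nondegenerate_dense gV gnd.
move=> f [[fs ftriv] fk] [[c0 a0 b0] _] L n layL hL liftNL Lback.
rewrite jet2_x0 in c0; rewrite jet2_xx// in a0; rewrite jet2_xl// in b0.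
split=> [lift b [bf _]|[mn _ card0 _]].
  (* Both kinds of lift in (i) keep the size of the first layer. *)
  have [mn card0] : (m <= n)%N /\ #|layer layL 0| = #|layer layN 0|.
    case: lift => [[mn low _]|[j [j0 [mn _ _ other]]]].
      by split; [exact: ltnW|exact: low].
    by split; [rewrite mn|apply: other => // /esym].
  exact: (equilibrium_lifted hN hL liftNL Lback mn fs c0 card0 bf).
have [c [d [c_first d_first cd rcd]]] :=
  synchrony_unique hN hL liftNL Lback (eq_leq mn) card0.
(* This is the linear condition defining [Vk]. *)
have h0 : dird (diag_dir R k.+1) f 0 = 0 by rewrite dird_diag.
have [b [bf bgap]] := gap_branch_exists fs ftriv c0 h0 a0 b0 hL c_first d_first cd.
by exists b; exact: (unlifted_branch rcd bf bgap).
Qed.
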